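(* Let $(M,g)$ be a (connected) Riemannian manifold and let $T^p_q(M)$ be its $(p,q)$-tensor bundle with the rescaled Sasaki type metric ${}^Sg_f$ and its metric connection ${}^{(M)}\widehat\nabla$. The following are equivalent: (a) for every geodesic $\widetilde\gamma$ on $T^p_q(M)$ with respect to ${}^{(M)}\widehat\nabla$, the projection $\gamma=\pi\circ\widetilde\gamma$ is a geodesic of the Levi-Civita connection $\nabla$ on $M$ and the tensor field $t^{v_1\dots v_p}_{r_1\dots r_q}(t)$ along $\gamma$ defined by $\widetilde\gamma$ has vanishing second covariant derivative along $\gamma$; (b) $f$ is constant.
   Context: All objects are smooth; Einstein summation. $f>0$ is a smooth function on $M$. $\Gamma_{ij}^h$ are the Christoffel symbols of the Levi-Civita connection $\nabla$ of $g$. ${}^fA_{ji}^h=f_j\delta_i^h+f_i\delta_j^h-f^hg_{ji}$, $f_i=\partial_if$, $f^h=g^{hm}f_m$. $\pi:T^p_q(M)\to M$ is the bundle of tensors of type $(p,q)$ ($p$ contravariant, $q$ covariant indices), with induced coordinates $(x^j,t^{i_1\dots i_p}_{j_1\dots j_q})$. The vertical lift of a $(p,q)$-tensor field $A$ is ${}^VA=A^{i_1\dots i_p}_{j_1\dots j_q}\partial/\partial t^{i_1\dots i_p}_{j_1\dots j_q}$; the horizontal lift of a vector field $X$ is $${}^HX=X^j\frac{\partial}{\partial x^j}+X^s\Big(\sum_{\mu=1}^q\Gamma_{sj_\mu}^mt^{i_1\dots i_p}_{j_1\dots m\dots j_q}-\sum_{\lambda=1}^p\Gamma_{sm}^{i_\lambda}t^{i_1\dots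 m\dots i_p}_{j_1\dots j_q}\Big)\frac{\partial}{\partial t^{i_1\dots i_p}_{j_1\dots j_q}}.$$ The metric ${}^Sg_f$ on $T^p_q(M)$ is defined by ${}^Sg_f({}^VA,{}^VB)=g_{i_1c_1}\cdots g_{i_pc_p}g^{j_1l_1}\cdots g^{j_ql_q}A^{i_1\dots i_p}_{j_1\dots j_q}B^{c_1\dots c_p}_{l_1\dots l_q}$, ${}^Sg_f({}^VA,{}^HY)=0$, ${}^Sg_f({}^HX,{}^HY)=f\,g(X,Y)$. The metric connection ${}^{(M)}\widehat\nabla$ (a connection with torsion satisfying ${}^{(M)}\widehat\nabla\,{}^Sg_f=0$) is the linear connection determined by ${}^{(M)}\widehat\nabla_{{}^H\partial_l}{}^H\partial_j={}^H\big((\Gamma_{lj}^r+\tfrac1{2f}{}^fA_{lj}^r)\partial_r\big)$, ${}^{(M)}\widehat\nabla_{{}^HX}{}^VB={}^V(\nabla_XB)$, ${}^{(M)}\widehat\nabla_{{}^VC}{}^HY=0$, ${}^{(M)}\widehat\nabla_{{}^VC}{}^VB=0$ for vector fields $X,Y$ and $(p,q)$-tensor fields $B,C$ on $M$. Geodesics are affinely parametrized, and the projection uses the same parameter. *)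

(* Defs.v *)
From HB Require Import structures.
From mathcomp Require Import all_boot all_order all_algebra.
From mathcomp Require Import all_classical all_reals all_analysis.

Set Implicit Arguments.
Unset Strict Implicit.
Unset Printing Implicit Defensive.

Import Order.TTheory GRing.Theory Num.Theory.
Import numFieldNormedType.Exports.

Local Open Scope classical_set_scope.
Local Open Scope ring_scope.

(** * Smooth functions on open subsets of R^n *)

Definition partial (R : realType) (n : nat) (i : 'I_n) (h : 'rV[R]_n -> R) :
    'rV[R]_n -> R :=
  fun y => 'D_(delta_mx 0 i) h y.

(* C^oo on an open set: every iterated partial derivative exists and is
   continuous. *)
Definition smooth_on (R : realType) (n : nat) (U : set 'rV[R]_n)
    (h : 'rV[R]_n -> R) : Prop :=
  forall (s : seq 'I_n) (y : 'rV[R]_n), U y ->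
    {for y, continuous (foldr (@partial R n) h s)} /\
    forall i : 'I_n, derivable (foldr (@partial R n) h s) y (delta_mx 0 i).

Definition smooth_vec_on (R : realType) (n m : nat) (U : set 'rV[R]_n)
    (F : 'rV[R]_n -> 'rV[R]_m) : Prop :=
  forall k : 'I_m, smooth_on U (fun y => F y 0 k).

(** * Manifolds *)

(* A set with coordinate charts, without conditions on the charts; see
   [smooth_manifold]. *)
Record atlas (R : realType) (n : nat) := Atlas {
  carrier :> Type;
  chart : Type;
  chart_dom : chart -> set carrier;
  chart_map : chart -> carrier -> 'rV[R]_n
}.

Arguments chart_dom {R n M} a : rename.
Arguments chart_map {R n M} a x : rename.

Section AtlasTopology.
Variables (R : realType) (n : nat) (M : atlas R n).

(* When the charts are injective with open images, this says that the image of
   A `&` chart_dom a under chart_map a is open for every chart a, i.e. it is the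
   manifold topology. *)
Definition atlas_open (A : set M) : Prop :=
  forall x, A x -> forall a : chart M, chart_dom a x ->
    \forall y \near chart_map a x,
      forall z, chart_dom a z -> chart_map a z = y -> A z.

Lemma atlas_openT : atlas_open setT.
Proof. by move=> x _ a _; near=> y. Unshelve. all: by end_near. Qed.

Lemma atlas_openI : setI_closed atlas_open.
Proof.
move=> A B oA oB x [Ax Bx] a ax.
have nA := oA x Ax a ax; have nB := oB x Bx a ax.
by apply: filterS2 nA nB => y hA hB z az zy; split; [exact: hA|exact: hB].
Qed.

Lemma atlas_open_bigcup (I : Type) (A : I -> set M) :
  (forall i, atlas_open (A i)) -> atlas_open (\bigcup_i A i).
Proof.
move=> oA x [i _ Aix] a ax.
by apply: filterS (oA i x Aix a ax) => y h z az zy; exists i => //; exact: h.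
Qed.

HB.instance Definition _ := gen_eqMixin (carrier M).
HB.instance Definition _ := gen_choiceMixin (carrier M).
HB.instance Definition _ := isOpenTopological.Build (carrier M)
  atlas_openT atlas_openI atlas_open_bigcup.

End AtlasTopology.

Definition chart_img (R : realType) (n : nat) (M : atlas R n) (a : chart M) :
    set 'rV[R]_n :=
  chart_map a @` chart_dom a.

(* F \o (chart_map a)^-1, with value 0 off chart_img a *)
Definition in_chart (R : realType) (n : nat) (M : atlas R n) (a : chart M)
    (V : zmodType) (F : M -> V) : 'rV[R]_n -> V :=
  fun y => xget 0 [set F x | x in [set x | chart_dom a x /\ chart_map a x = y]].

Definition trans (R : realType) (n : nat) (M : atlas R n) (a b : chart M) :
    'rV[R]_n -> 'rV[R]_n :=
  in_chart a (chart_map b).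

(* With x the coordinates of a and y those of b: the entry (i, k) is
   d y^k / d x^i at the point z. *)
Definition jac (R : realType) (n : nat) (M : atlas R n) (a b : chart M)
    (z : M) : 'M[R]_n :=
  \matrix_(i, k) partial i (fun y => trans a b y 0 k) (chart_map a z).

Definition smooth_manifold (R : realType) (n : nat) (M : atlas R n) : Prop :=
  [/\ forall x : M, exists a : chart M, chart_dom a x,
      forall (a : chart M) (x y : M), chart_dom a x -> chart_dom a y ->
        chart_map a x = chart_map a y -> x = y,
      forall a b : chart M,
        let U := chart_map a @` (chart_dom a `&` chart_dom b) in
        open U /\ smooth_vec_on U (trans a b),
      hausdorff_space M
    & @second_countable M].

Definition smooth_function (R : realType) (n : nat) (M : atlas R n)
    (f : M -> R) : Prop :=
  forall a : chart M, smooth_on (chart_img a) (in_chart a f).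

(** * Metrics, connections and geodesics, in coordinates *)

(* [gram a y] is the matrix (g_ij) in the chart a, at the point with coordinates
   y; only its values on chart_img a are meaningful. *)
Record riemannian (R : realType) (n : nat) (M : atlas R n) := Riemannian {
  gram : chart M -> 'rV[R]_n -> 'M[R]_n;
  gram_smooth : forall a i j,
    smooth_on (chart_img a) (fun y => gram a y i j);
  gram_sym : forall a y, chart_img a y -> (gram a y)^T = gram a y;
  gram_pos : forall a y, chart_img a y -> forall v : 'rV[R]_n, v != 0 ->
    0 < (v *m gram a y *m v^T) 0 0;
  gram_law : forall (a b : chart M) (x : M),
    chart_dom a x -> chart_dom b x ->
    gram a (chart_map a x) =
      jac a b x *m gram b (chart_map b x) *m (jac a b x)^T
}.

(* [gam a h i j] is the coefficient Gamma^h_ij in the chart a, with the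
   convention nabla_{d_i} d_j = Gamma^h_ij d_h. No symmetry is required. *)
Record connection (R : realType) (n : nat) (M : atlas R n) := Connection {
  gam : chart M -> 'I_n -> 'I_n -> 'I_n -> 'rV[R]_n -> R;
  gam_smooth : forall a h i j, smooth_on (chart_img a) (gam a h i j);
  gam_law : forall (a b : chart M) (x : M), chart_dom a x -> chart_dom b x ->
    forall i j k : 'I_n,
      \sum_h gam a h i j (chart_map a x) * jac a b x h k =
      partial i (partial j (fun y => trans a b y 0 k)) (chart_map a x) +
      \sum_u \sum_v jac a b x i u * jac a b x j v *
                    gam b k u v (chart_map b x)
}.

Section Connections.
Variables (R : realType) (n : nat) (M : atlas R n).
Variables (D : connection M) (g : riemannian M).

(* nabla_X Y for vector fields on the domain of the chart a *)
Definition nabla_vec (a : chart M) (X Y : 'rV[R]_n -> 'rV[R]_n) :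
    'rV[R]_n -> 'rV[R]_n :=
  fun y => \row_h
    (\sum_i X y 0 i * partial i (fun z => Y z 0 h) y +
     \sum_i \sum_j gam D a h i j y * X y 0 i * Y y 0 j).

(* nabla g = 0 *)
Definition parallel_metric : Prop :=
  forall (a : chart M) y, chart_img a y -> forall i j k : 'I_n,
    partial k (fun z => gram g a z i j) y =
      \sum_m (gam D a m k i y * gram g a y m j +
              gam D a m k j y * gram g a y i m).

Definition torsion_free : Prop :=
  forall (a : chart M) y, chart_img a y -> forall h i j : 'I_n,
    gam D a h i j y = gam D a h j i y.

(* C^oo in the charts; the first clause is continuity. *)
Definition smooth_curve (J : set R) (c : R -> M) : Prop :=
  forall t, J t -> forall a : chart M, chart_dom a (c t) ->
    (\forall s \near t, chart_dom a (c s)) /\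
    forall (k : 'I_n) (l : nat),
      derivable (derive1n l (fun s => chart_map a (c s) 0 k)) t 1.

Definition geodesic (J : set R) (c : R -> M) : Prop :=
  smooth_curve J c /\
  forall t, J t -> forall a : chart M, chart_dom a (c t) ->
    let x k := fun s => chart_map a (c s) 0 k in
    forall h : 'I_n,
      derive1n 2 (x h) t +
      \sum_i \sum_j gam D a h i j (chart_map a (c t)) *
                    derive1 (x i) t * derive1 (x j) t = 0.

End Connections.

Definition levi_civita (R : realType) (n : nat) (M : atlas R n)
    (g : riemannian M) (D : connection M) : Prop :=
  torsion_free D /\ parallel_metric D g.

(** * Tensors of type (p, q) *)

(* multi-indices (i_1 ... i_p, j_1 ... j_q) *)
Definition tidx (n p q : nat) : finType :=
  ({ffun 'I_p -> 'I_n} * {ffun 'I_q -> 'I_n})%type.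

Notation tdim n p q := #|{: tidx n p q}|.

Definition tcoef (R : realType) (n p q : nat) (t : 'rV[R]_(tdim n p q))
    (i : {ffun 'I_p -> 'I_n}) (j : {ffun 'I_q -> 'I_n}) : R :=
  t 0 (enum_rank ((i, j) : tidx n p q)).

Definition mktensor (R : realType) (n p q : nat)
    (F : {ffun 'I_p -> 'I_n} -> {ffun 'I_q -> 'I_n} -> R) :
    'rV[R]_(tdim n p q) :=
  \row_k F (enum_val k).1 (enum_val k).2.

(* the multi-index i_1 ... m ... i_p, with m at the position l *)
Definition subst_idx (n p : nat) (i : {ffun 'I_p -> 'I_n}) (l : 'I_p)
    (m : 'I_n) : {ffun 'I_p -> 'I_n} :=
  [ffun k => if k == l then m else i k].

(* A tensor at x is a family of components, one for each chart around x, obeying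
   the tensor transformation law. The components in the other charts are set to 0
   so that a tensor has only one representation. *)
Record tensor_at (R : realType) (n : nat) (M : atlas R n) (p q : nat) (x : M) :=
  TensorAt {
  comp : chart M -> 'rV[R]_(tdim n p q);
  comp_out : forall a : chart M, ~ chart_dom a x -> comp a = 0;
  comp_law : forall a b : chart M, chart_dom a x -> chart_dom b x ->
    forall (i' : {ffun 'I_p -> 'I_n}) (j' : {ffun 'I_q -> 'I_n}),
      tcoef (comp b) i' j' =
      \sum_(i : {ffun 'I_p -> 'I_n}) \sum_(j : {ffun 'I_q -> 'I_n})
        (\prod_l jac a b x (i l) (i' l)) * (\prod_m jac b a x (j' m) (j m)) *
        tcoef (comp a) i j
}.

(* T^p_q(M), with the induced coordinates (x, t) *)
Definition tensor_bundle (R : realType) (n : nat) (M : atlas R n)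
    (p q : nat) : atlas R (n + tdim n p q) :=
  @Atlas R (n + tdim n p q) {x : M & tensor_at p q x} (chart M)
    (fun a u => chart_dom a (projT1 u))
    (fun a u => row_mx (chart_map a (projT1 u)) (comp (projT2 u) a)).

Definition bundle_proj (R : realType) (n : nat) (M : atlas R n) (p q : nat)
    (u : tensor_bundle M p q) : M := projT1 u.

Definition bundle_comp (R : realType) (n : nat) (M : atlas R n) (p q : nat)
    (a : chart M) (u : tensor_bundle M p q) : 'rV[R]_(tdim n p q) :=
  comp (projT2 u) a.

Section Tensors.
Variables (R : realType) (n : nat) (M : atlas R n) (p q : nat).
Variable D : connection M.

Local Notation K := (tdim n p q).

(* The zeroth-order part of nabla_{d_s} on tensors:
   sum_l Gamma^{i_l}_{sm} t^{..m..}_j - sum_u Gamma^m_{s j_u} t^i_{..m..} *)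
Definition gam_act (a : chart M) (s : 'I_n) (y : 'rV[R]_n) (t : 'rV[R]_K) :
    'rV[R]_K :=
  mktensor (fun i j =>
    \sum_l \sum_m gam D a (i l) s m y * tcoef t (subst_idx i l m) j -
    \sum_u \sum_m gam D a m s (j u) y * tcoef t i (subst_idx j u m)).

(* nabla_X B for fields on the domain of the chart a *)
Definition nabla_tensor (a : chart M) (X : 'rV[R]_n -> 'rV[R]_n)
    (B : 'rV[R]_n -> 'rV[R]_K) : 'rV[R]_n -> 'rV[R]_K :=
  fun y => \sum_s X y 0 s *:
    (\row_k partial s (fun z => B z 0 k) y + gam_act a s y (B y)).

(* The covariant derivative along the curve with coordinates x of the tensor
   field along it with components T, in the chart a. *)
Definition nabla_along (a : chart M) (x : R -> 'rV[R]_n) (T : R -> 'rV[R]_K) :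
    R -> 'rV[R]_K :=
  fun t => \row_k derive1 (fun r => T r 0 k) t +
    \sum_s derive1 (fun r => x r 0 s) t *: gam_act a s (x t) (T t).

Definition vanishing_second_derivative (J : set R)
    (c : R -> tensor_bundle M p q) : Prop :=
  forall t, J t -> forall a : chart M, chart_dom a (bundle_proj (c t)) ->
    let x s := chart_map a (bundle_proj (c s)) in
    let T s := bundle_comp a (c s) in
    nabla_along a x (nabla_along a x T) t = 0.

(** Lifts of fields on the domain of a chart, in the induced coordinates; the
    argument w is (x, t). *)

Definition vlift (B : 'rV[R]_n -> 'rV[R]_K) : 'rV[R]_(n + K) -> 'rV[R]_(n + K) :=
  fun w => row_mx 0 (B (lsubmx w)).

Definition hlift (a : chart M) (X : 'rV[R]_n -> 'rV[R]_n) :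
    'rV[R]_(n + K) -> 'rV[R]_(n + K) :=
  fun w => let y := lsubmx w in
    row_mx (X y) (- (\sum_s X y 0 s *: gam_act a s y (rsubmx w))).

Definition tensor_inner (G : 'M[R]_n) (A B : 'rV[R]_K) : R :=
  \sum_(i : {ffun 'I_p -> 'I_n}) \sum_(c : {ffun 'I_p -> 'I_n})
  \sum_(j : {ffun 'I_q -> 'I_n}) \sum_(l : {ffun 'I_q -> 'I_n})
    (\prod_k G (i k) (c k)) * (\prod_k invmx G (j k) (l k)) *
    tcoef A i j * tcoef B c l.

Variables (g : riemannian M) (f : M -> R).

(* The metric ^S g_f *)
Definition rescaled_sasaki (G : riemannian (tensor_bundle M p q)) : Prop :=
  forall (a : chart M) (X Y : 'rV[R]_n -> 'rV[R]_n) (A B : 'rV[R]_n -> 'rV[R]_K),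
    smooth_vec_on (chart_img a) X -> smooth_vec_on (chart_img a) Y ->
    smooth_vec_on (chart_img a) A -> smooth_vec_on (chart_img a) B ->
    forall w, @chart_img R _ (tensor_bundle M p q) a w ->
    let y := lsubmx w in
    let ip U V := (U w *m gram G a w *m (V w)^T) 0 0 in
    [/\ ip (vlift A) (vlift B) = tensor_inner (gram g a y) (A y) (B y),
        ip (vlift A) (hlift a Y) = 0
      & ip (hlift a X) (hlift a Y) =
        in_chart a f y * (X y *m gram g a y *m (Y y)^T) 0 0].

(* ^f A_ji^h = f_j delta_i^h + f_i delta_j^h - f^h g_ji *)
Definition fA (a : chart M) (j i h : 'I_n) (y : 'rV[R]_n) : R :=
  let df k := partial k (in_chart a f) y in
  df j * (i == h)%:R + df i * (j == h)%:R -
  (\sum_m invmx (gram g a y) h m * df m) * gram g a y j i.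

Definition coord_field (j : 'I_n) : 'rV[R]_n -> 'rV[R]_n :=
  fun _ => delta_mx 0 j.

(* The linear connection [Dh] on T^p_q(M) is the metric connection of [G]. *)
Definition metric_connection (G : riemannian (tensor_bundle M p q))
    (Dh : connection (tensor_bundle M p q)) : Prop :=
  parallel_metric Dh G /\
  forall (a : chart M) (w : 'rV[R]_(n + K)),
    @chart_img R _ (tensor_bundle M p q) a w ->
  [/\ forall l j : 'I_n,
        nabla_vec Dh a (hlift a (coord_field l)) (hlift a (coord_field j)) w =
        hlift a (fun y => \row_r (gam D a r l j y +
                                  (2 * in_chart a f y)^-1 * fA a l j r y)) w,
      forall X B, smooth_vec_on (chart_img a) X ->
        smooth_vec_on (chart_img a) B ->
        nabla_vec Dh a (hlift a X) (vlift B) w = vlift (nabla_tensor a X B) w,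
      forall C Y, smooth_vec_on (chart_img a) C ->
        smooth_vec_on (chart_img a) Y ->
        nabla_vec Dh a (vlift C) (hlift a Y) w = 0
    & forall C B, smooth_vec_on (chart_img a) C ->
        smooth_vec_on (chart_img a) B ->
        nabla_vec Dh a (vlift C) (vlift B) w = 0].

End Tensors.

(* Main.v *)
Require Import Defs.
From HB Require Import structures.
From mathcomp Require Import all_boot all_order all_algebra.
From mathcomp Require Import all_classical all_reals all_analysis.
From mathcomp Require Import ring lra.

Set Implicit Arguments.
Unset Strict Implicit.
Unset Printing Implicit Defensive.

Import Order.TTheory GRing.Theory Num.Theory.
Import numFieldNormedType.Exports.

Local Open Scope classical_set_scope.
Local Open Scope ring_scope.

(** Write a tangent vector of the bundle at the point with coordinates (y, t) as
    W = (v, u), and let Gamma(v) be the matrix by which nabla_v acts, to order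
    zero, on tensor components (gam_dir). The four identities that determine the
    metric connection are stated on horizontal and vertical lifts; subtracting
    from each the derivative of the lifted field turns them into values of the
    Christoffel symbols of the bundle on lifts. Splitting W into the horizontal
    lift of v and the vertical vector u + t Gamma(v) gives the whole quadratic
    form of these symbols (bundle_conn_form):
      - the base component is Gamma(v, v) + Q(v) / (2 f), where
        Q(v) = 2 df(v) v - |v|^2 grad f  (rescaling_formE);
      - the fibre component is the one for which, once the base equation holds,
        the fibre equation says exactly that the second covariant derivative of
        the tensor along the projected curve vanishes (nabla_along_twice,
        bundle_geodesic_equationP).

    So the tensor along a geodesic of the bundle always has vanishing second
    covariant derivative, and everything depends on the base equation
    x'' + Gamma(x', x') + Q(x') / (2 f) = 0. If f is constant then Q = 0 and this
    is the geodesic equation of nabla.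

    Conversely, suppose that all projections are geodesics of nabla. A solution of
    the base equation, with the zero tensor along it, is a geodesic of the bundle
    (zero_section_geodesic); hence Q(v) = 0 for each initial velocity v of such a
    solution. Solutions exist for every initial velocity
    (rescaled_geodesic_exists), in particular for v = grad f, where
    Q(v) = |grad f|^2 grad f; therefore df = 0 everywhere
    (projection_geodesic_critical). Then f is locally constant, and constant
    because M is connected (critical_constant).

    Existence rests on an ordinary differential equation solved by Picard
    iteration (picard_lipschitz, local_ode_solution,
    local_second_order_solution). As geodesics are curves in a manifold given by
    charts, it also has to be seen that x'' + Gamma(x', x') and Q(x') transform
    as vectors under changes of chart (conn_form_chart_change,
    rescaling_form_change). *)

(** * The mean value theorem in a ball *)

Lemma rowv_normr_leP (R : realType) n (v : 'rV[R]_n) (e : R) : 0 <= e ->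
  (`|v| <= e) <-> (forall k, `|v 0 k| <= e).
Proof.
move=> e0; rewrite [X in X <= _]/Num.Def.normr/= mx_normrE; split=> [ve k|ve].
  exact: le_trans (le_bigmax _ (fun i => `|v i.1 i.2|) (0, k)) ve.
by apply: bigmax_le => //= -[i k] _ /=; rewrite (ord1 i).
Qed.

Lemma coord_le_normr (R : realType) n (v : 'rV[R]_n) k : `|v 0 k| <= `|v|.
Proof. exact: ((rowv_normr_leP v (normr_ge0 v)).1 (lexx _) k). Qed.

Lemma rowv_ballP (R : realType) n (c v : 'rV[R]_n) (e : R) : 0 < e ->
  ball c e v <-> (forall k, `|c 0 k - v 0 k| < e).
Proof.
move=> e0; split=> [[_ cv] k|cv]; first exact: (cv 0 k).
by split=> // i k; rewrite (ord1 i); exact: cv.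
Qed.

(** Directional derivatives are one-variable derivatives along a line; this lets
    one-variable theorems be used in one direction at a time. *)
Lemma is_derive_line (R : realType) (V W : normedModType R) (h : V -> W)
    (y v : V) (s : R) (d : W) :
  is_derive (s *: v + y) v h d <-> is_derive s 1 (fun s => h (s *: v + y)) d.
Proof.
have E : (fun e : R => e^-1 *: ((h \o shift (s *: v + y)) (e *: v) - h (s *: v + y)))
  = (fun e : R => e^-1 *: (((fun s => h (s *: v + y)) \o shift s) (e *: 1) -
                       h (s *: v + y))).
  by apply/funext => e /=; rewrite [e%:A]mulr1 scalerDl addrA.
split=> -[dh <-]; split.
- by rewrite /derivable -E.
- by rewrite /derive -E.
- by rewrite /derivable E.
- by rewrite /derive E.
Qed.

(** The segments that join w' to w one coordinate at a time stay in the ball,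
    which is a box for the norm of row vectors; the one-variable mean value
    theorem is applied on each of them. *)
Lemma mean_value_ball (R : realType) n (h : 'rV[R]_n -> R) (c : 'rV[R]_n) (r : R) :
  (forall y, ball c r y -> forall i, derivable h y (delta_mx 0 i)) ->
  forall w w', ball c r w -> ball c r w' ->
  exists2 xi : 'I_n -> 'rV[R]_n, (forall i, ball c r (xi i)) &
    h w - h w' = \sum_i (w 0 i - w' 0 i) * partial i h (xi i).
Proof.
move=> dh w w' cw cw'; have r0 : 0 < r by case: cw.
pose z (k : nat) : 'rV[R]_n := \row_j if (j < k)%N then w 0 j else w' 0 j.
have zw' : z 0%N = w' by apply/rowP => j; rewrite mxE.
have zw : z n = w by apply/rowP => j; rewrite mxE ltn_ord.
have zS (i : 'I_n) : z i.+1 = (w 0 i - w' 0 i) *: delta_mx 0 i + z i.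
  apply/rowP => j; rewrite !mxE eqxx/= ltnS leq_eqVlt.
  have [->|/negPf ij] := eqVneq j i; first by rewrite eqxx ltnn mulr1 subrK.
  by rewrite (inj_eq val_inj) ij/= mulr0 add0r.
have seg (i : 'I_n) (s : R) : 0 <= s <= 1 ->
    ball c r ((s * (w 0 i - w' 0 i)) *: delta_mx 0 i + z i).
  move=> s01; apply/(rowv_ballP _ _ r0) => j; rewrite !mxE eqxx/=.
  move: cw cw' => /(rowv_ballP _ _ r0)/(_ j) + /(rowv_ballP _ _ r0)/(_ j).
  have [->|/negPf ij] := eqVneq j i; last first.
    by rewrite mulr0 add0r; case: ifP.
  move=> wj w'j; rewrite ltnn mulr1.
  have -> : c 0 i - (s * (w 0 i - w' 0 i) + w' 0 i) =
      s * (c 0 i - w 0 i) + (1 - s) * (c 0 i - w' 0 i) by ring.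
  move: s01 => /andP[s0 s1]; apply: le_lt_trans (ler_normD _ _) _.
  rewrite !normrM (ger0_norm s0) (@ger0_norm _ (1 - s)) ?subr_ge0//.
  have : Num.max `|c 0 i - w 0 i| `|c 0 i - w' 0 i| < r by rewrite gt_max wj.
  apply: le_lt_trans; set m := Num.max _ _.
  have -> : m = s * m + (1 - s) * m by ring.
  by rewrite lerD// ler_wpM2l ?subr_ge0// /m le_max lexx ?orbT.
have mv (i : 'I_n) : exists xi, ball c r xi /\
    h (z i.+1) - h (z i) = (w 0 i - w' 0 i) * partial i h xi.
  set a := w 0 i - w' 0 i.
  pose g (s : R) := h (s *: delta_mx 0 i + z i).
  have dg (s : R) : 0 <= s <= 1 -> is_derive s 1 (g \o ( *%R^~ a))
      (partial i h ((s * a) *: delta_mx 0 i + z i) * a).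
    move=> s01; apply: is_derive1_comp.
      by apply: (is_derive_line _ _ _ _ _).1; apply: derivableP; exact/dh/seg.
    have := is_deriveM (is_derive_id s 1) (is_derive_cst a s 1).
    by move/is_derive_eq; apply; rewrite /GRing.scale/= mulr0 add0r mulr1.
  have [||s sa E] := @MVT_segment R (g \o ( *%R^~ a))
    (fun s => partial i h ((s * a) *: delta_mx 0 i + z i) * a) 0 1 ler01.
  - by move=> s /subset_itv_oo_cc; rewrite in_itv/=; exact: dg.
  - apply: continuous_in_subspaceT => s; rewrite inE/= in_itv/= => s01.
    by apply: differentiable_continuous; apply/derivable1_diffP; case: (dg s s01).
  exists ((s * a) *: delta_mx 0 i + z i); split.
    by apply: seg; rewrite in_itv/= in sa.
  move: E; rewrite /= /g mul1r mul0r scale0r add0r subr0 mulr1 mulrC => <-.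
  by rewrite zS.
have [xi xiP] := choice mv.
exists xi => [i|]; first by have [] := xiP i.
rewrite -[in LHS]zw -[in LHS]zw' -(telescope_sumr (h \o z) (leq0n n)) big_mkord.
by apply: eq_bigr => i _; have [] := xiP i.
Qed.

(** * Functions with continuous partial derivatives *)

Section DotProduct.
Variables (R : realType) (n : nat) (a : 'rV[R]_n).

(** The candidate for the differential at a point where a is the row of partial
    derivatives. *)
Definition dotv (v : 'rV[R]_n) : R := \sum_i v 0 i * a 0 i.

Fact dotv_is_linear : linear dotv.
Proof.
move=> k u v; rewrite /dotv /GRing.scale/= mulr_sumr -big_split/=.
by apply: eq_bigr => i _; rewrite !mxE mulrDl mulrA.
Qed.
HB.instance Definition _ := GRing.isLinear.Build R 'rV[R]_n R _ dotv dotv_is_linear.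

Lemma dotv_continuous : continuous dotv.
Proof.
apply: (@continuous_big R 'I_n +%R 0 xpredT _ _ (index_enum _)
  (fun i (v : 'rV[R]_n) => v 0 i * a 0 i)) => [|i _].
  exact: add_continuous.
by move=> v; exact: (cvgM (@coord_continuous R 1 n 0 i v) (cvg_cst (a 0 i))).
Qed.

End DotProduct.

(** The differential is defined by choice among linear maps; a first-order
    expansion determines it. *)
Lemma differentiable_of_expansion (R : numFieldType) (V W : normedModType R)
    (f : V -> W) (df : {linear V -> W}) (x : V) :
  continuous df -> f \o shift x = cst (f x) + df +o_ 0 id -> differentiable f x.
Proof.
move=> cdf E; have dE := diff_unique cdf E.
by apply/diff_locallyP; rewrite dE.
Qed.

(** By the mean value theorem the remainder at v is
    sum_i v_i (d_i h(xi_i) - d_i h(y)) with xi_i as close to y as v is to 0, and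
    the partial derivatives are continuous at y. *)
Lemma continuous_partials_differentiable (R : realType) n (h : 'rV[R]_n -> R)
    (y : 'rV[R]_n) :
  (\forall z \near y, forall i, derivable h z (delta_mx 0 i)) ->
  (forall i, {for y, continuous (partial i h)}) ->
  differentiable h y.
Proof.
move=> dh ch; pose a := \row_i partial i h y.
apply: (differentiable_of_expansion (@dotv_continuous _ _ a)).
apply/eqaddoP => _/posnumP[e].
  (* n.+1 rather than n because n may be 0. *)
  pose e' := e%:num / n.+1%:R.
  have e'0 : 0 < e' by rewrite divr_gt0.
  have : \forall z \near y, forall i,
      derivable h z (delta_mx 0 i) /\ `|partial i h y - partial i h z| <= e'.
    near=> z => i; split; first by move: i; near: z.
    move: i; near: z; apply: filter_forall => i.
    by have /cvgrPdist_le/(_ e' e'0) := ch i.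
  move=> /nbhs_ballP[r/= r0 Hr].
  have : nbhs (0 : 'rV[R]_n) (ball (0 : 'rV[R]_n) r) by exact: nbhsx_ballx.
  apply: filterS => v.
  rewrite -ball_normE/= /ball_/= sub0r normrN => vr.
  have yball (z : 'rV[R]_n) : `|z| <= `|v| -> ball y (r) (z + y).
    move=> zv; rewrite -ball_normE/= /ball_/= opprD addrCA subrr addr0 normrN.
    exact: le_lt_trans zv vr.
  have [|xi xiP] := @mean_value_ball R n h y r _ (v + y) y (yball _ (lexx _)) (ballxx _ r0).
    by move=> z /Hr/[swap] i /(_ i)[].
  rewrite /= -![(_ + _ : _ -> _) _]/(_ + _) -![(- _ : _ -> _) _]/(- _)/=.
  rewrite /cst/= opprD addrA => ->; rewrite /dotv -sumrB.
  apply: le_trans (ler_norm_sum _ _ _) _.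
  apply: (@le_trans _ _ (\sum_(i < n) e' * `|v|)).
    apply: ler_sum => i _; rewrite !mxE addrK -mulrBr normrM mulrC.
    apply: ler_pM => //; last exact: coord_le_normr.
    by rewrite distrC; have [] := Hr _ (xiP i) i.
  rewrite sumr_const card_ord -mulrnAl -mulr_natl.
  apply: ler_wpM2r => //; rewrite /e' mulrA ler_pdivrMr// mulrC.
  by rewrite ler_wpM2l// ler_nat.
Unshelve. all: by end_near. Qed.

Lemma smooth_on_partial (R : realType) n (U : set 'rV[R]_n) (h : 'rV[R]_n -> R) i :
  smooth_on U h -> smooth_on U (partial i h).
Proof. by move=> sh s y Uy; rewrite -foldr_rcons; exact: sh. Qed.

Lemma smooth_on_differentiable (R : realType) n (U : set 'rV[R]_n)
    (h : 'rV[R]_n -> R) y :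
  open U -> smooth_on U h -> U y -> differentiable h y.
Proof.
move=> oU sh Uy; apply: continuous_partials_differentiable => [|i]; last first.
  by have [] := sh [:: i] y Uy.
have := open_nbhs_nbhs (conj oU Uy); apply: filterS => z Uz i.
by have [_] := sh [::] z Uz; apply.
Qed.

(** Partial derivatives determine all directional derivatives; this fails
    without differentiability. *)
Lemma derive_sum_partial (R : realType) n (h : 'rV[R]_n -> R) (y v : 'rV[R]_n) :
  differentiable h y -> 'D_v h y = \sum_i v 0 i * partial i h y.
Proof.
move=> dh; rewrite deriveE// {1}(row_sum_delta v) linear_sum/=.
by apply: eq_bigr => i _; rewrite linearZ/= /partial deriveE.
Qed.

Lemma derivable_rowv (R : realType) n (x : R -> 'rV[R]_n) (t : R) :
  (forall k, derivable (fun s => x s 0 k) t 1) -> derivable x t 1.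
Proof. by move=> dx; apply/derivable_mxP => i k; rewrite (ord1 i). Qed.

Lemma is_derive_chain (R : realType) n (h : 'rV[R]_n -> R) (x : R -> 'rV[R]_n)
    (t : R) :
  differentiable h (x t) -> (forall k, derivable (fun s => x s 0 k) t 1) ->
  is_derive t 1 (h \o x)
    (\sum_i derive1 (fun s => x s 0 i) t * partial i h (x t)).
Proof.
move=> dh dx; have dx' := derivable_rowv dx.
have dfx : differentiable x t by exact/derivable1_diffP.
split; first by apply/derivable1_diffP; exact: differentiable_comp.
rewrite deriveE; last exact: differentiable_comp.
rewrite diff_comp//= -!deriveE// derive_sum_partial//.
by apply: eq_bigr => i _; rewrite derive_mx// mxE derive1E.
Qed.

(** * Antiderivatives, geometric convergence and truncation *)

(** The integral of phi from - 1 to t. The base point lies to the left of 0 so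
    that the fundamental theorem of calculus applies on both sides of 0. *)
Lemma exists_antiderivative (R : realType) (phi : R -> R) :
  continuous phi ->
  exists2 Phi : R -> R, Phi 0 = 0 &
    forall t : R, `|t| < 1 -> is_derive t 1 Phi (phi t).
Proof.
move=> cphi; pose mu := @lebesgue_measure R.
pose F (x : R) := (\int[mu]_(t in [set` Interval (BLeft (- 1)) (BRight x)]) phi t)%R.
have dF (t : R) : `|t| < 1 -> is_derive t 1 F (phi t).
  rewrite ltr_norml => /andP[t1 t1'].
  have ip : mu.-integrable `[(- 1), 1] (EFin \o phi).
    apply: continuous_compact_integrable; first exact: segment_compact.
    exact: continuous_subspaceT.
  have [dFt Ft] := @continuous_FTC1_closed R phi (- 1) t 1 t1' ip t1 (cphi t).
  split; first exact: dFt.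
  by rewrite -derive1E; exact: Ft.
exists (fun t => F t - F 0) => [|t t1]; first exact: subrr.
have := is_deriveB (dF t t1) (is_derive_cst (F 0) t 1).
by move/is_derive_eq; apply; rewrite subr0.
Qed.

Lemma derive_bound_lipschitz (R : realType) (Phi phi : R -> R) (C : R) :
  (forall t : R, `|t| < 1 -> is_derive t 1 Phi (phi t)) ->
  (forall t : R, `|phi t| <= C) ->
  forall t s : R, `|t| < 1 -> `|s| < 1 -> `|Phi t - Phi s| <= C * `|t - s|.
Proof.
move=> dP bP t s.
wlog st : t s / s <= t.
  move=> H t1 s1; have [st|/ltW ts] := leP s t; first exact: H.
  by rewrite distrC [X in _ * X]distrC; exact: H.
rewrite !ltr_norml => /andP[t1 t1'] /andP[s1 s1'].
have I (x : R) : x \in `[s, t]%R -> is_derive x 1 Phi (phi x).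
  rewrite in_itv/= => /andP[sx xt]; apply: dP.
  by rewrite ltr_norml (lt_le_trans s1 sx) (le_lt_trans xt t1').
have cP : {within `[s, t], continuous Phi}.
  apply: continuous_in_subspaceT => x; rewrite inE => xst.
  by apply: differentiable_continuous; apply/derivable1_diffP; case: (I x xst).
have [c _ E] := MVT_segment st (fun x xst => I x (subset_itv_oo_cc xst)) cP.
by rewrite E normrM ler_wpM2r.
Qed.

Lemma lipschitz_continuous (R : realType) (phi : R -> R) (C : R) :
  (forall t s : R, `|phi t - phi s| <= C * `|t - s|) -> continuous phi.
Proof.
move=> lp t; apply/cvgrPdist_le => e e0.
have C1 : 0 < `|C| + 1 by rewrite ltr_wpDl.
near=> s.
apply: le_trans (lp t s) _.
apply: (@le_trans _ _ ((`|C| + 1) * `|t - s|)).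
  by rewrite ler_wpM2r// (le_trans (ler_norm C))// lerDl.
rewrite -ler_pdivlMl// mulrC.
by near: s; apply: cvgr_dist_le; [exact: cvg_id|rewrite divr_gt0].
Unshelve. all: by end_near. Qed.

Lemma ler_geometric_limit (R : realType) (C x y : R) :
  (forall n, x <= y + C / 2 ^+ n) -> x <= y.
Proof.
move=> H; apply/ler_addgt0Pl => e e0.
pose n := Num.bound (`|C| / e).
apply: le_trans (H n) _; rewrite addrC lerD2r ler_pdivrMr ?exprn_gt0//.
apply: le_trans (ler_norm C) _.
rewrite mulrC -ler_pdivrMr//; apply: ltW.
apply: lt_le_trans (archi_boundP _) _; first by rewrite divr_ge0// ltW.
by rewrite -natrX ler_nat ltnW// ltn_expl.
Qed.

(** With d_n = 2 B / 2^n, the intervals [a_n - d_n, a_n + d_n] are nested; the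
    limit is the supremum of their left ends, which gives the rate together with
    the existence. *)
Lemma geometric_increments_limit (R : realType) (a : nat -> R) (B : R) :
  (forall n, `|a n.+1 - a n| <= B / 2 ^+ n) ->
  exists l, forall n, `|a n - l| <= 2 * B / 2 ^+ n.
Proof.
move=> H; pose d n : R := 2 * B / 2 ^+ n.
have dS n : d n = d n.+1 + B / 2 ^+ n.
  by rewrite /d exprS invfM; field; rewrite expf_neq0.
have B0 n : 0 <= B / 2 ^+ n by exact: le_trans (normr_ge0 _) (H n).
have d0 n : 0 <= d n by rewrite /d -mulrA mulr_ge0.
have up m n : (n <= m)%N -> a m - d m >= a n - d n /\ a m + d m <= a n + d n.
  elim: m => [|m IH]; first by rewrite leqn0 => /eqP ->.
  rewrite leq_eqVlt => /predU1P[->//|/IH[IH1 IH2]].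
  have := H m; rewrite ler_norml => /andP[h1 h2].
  by have := dS m; split; lra.
pose E := [set x | exists n, x = a n - d n].
have cross m n : a m - d m <= a n + d n.
  have [/up[h1 h2]|/ltnW/up[h1 h2]] := leqP n m; have := d0 m; have := d0 n; lra.
have hs : has_sup E.
  split; first by exists (a 0%N - d 0%N); exists 0%N.
  by exists (a 0%N + d 0%N) => _ [m ->]; exact: cross.
exists (sup E) => n; rewrite -/(d n) ler_distl; apply/andP; split; last first.
  rewrite -lerBlDr; apply: (ub_le_sup hs.2); by exists n.
rewrite lerBlDr; apply: ge_sup; first exact: hs.1.
by move=> _ [m ->].
Qed.

(** Truncation to [- d, d], for 0 <= d. Applied to times it extends the Picard
    operator to functions on the whole line; applied to coordinates it makes a
    field that is Lipschitz on a ball Lipschitz everywhere. *)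
Definition clamp (R : realType) (d x : R) : R := Num.max (- d) (Num.min d x).

Lemma clamp_norm (R : realType) (d x : R) : 0 <= d -> `|clamp d x| <= d.
Proof.
move=> d0; rewrite /clamp ler_norml le_max lexx/= ge_max ge_min lexx/= andbT.
by rewrite (le_trans _ d0)// oppr_le0.
Qed.

Lemma clamp_id (R : realType) (d x : R) : `|x| <= d -> clamp d x = x.
Proof.
by rewrite ler_norml => /andP[dx xd]; rewrite /clamp (min_idPr xd) (max_idPr dx).
Qed.

Lemma clamp_lipschitz (R : realType) (d x y : R) :
  `|clamp d x - clamp d y| <= `|x - y|.
Proof.
wlog xy : x y / x <= y.
  move=> H; have [/H//|/ltW/H] := leP x y.
  by rewrite distrC [X in _ <= X -> _]distrC.
rewrite distrC [leRHS]distrC [leRHS]ger0_norm ?subr_ge0// /clamp.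
case: (leP d x) => ?; case: (leP d y) => ?; case: (leP (- d) d) => ?;
  case: (leP (- d) x) => ?; case: (leP (- d) y) => ?;
  by rewrite ler_norml; apply/andP; split; lra.
Qed.

(** * Picard iteration *)

Lemma near_normr_lt (R : realType) (d t : R) :
  `|t| < d -> \forall s \near t, `|s| < d.
Proof.
move=> td; apply/nbhs_ballP; exists (d - `|t|) => /=; first by rewrite subr_gt0.
move=> s; rewrite -ball_normE/= ltrBrDl => ts.
by apply: le_lt_trans ts; rewrite -{1}(subrK t s) distrC addrC ler_normD.
Qed.

(** For L d <= 1 / 2 the Picard operator on [- d, d] halves uniform distances, so
    its iterates converge geometrically to a fixed point. Times are truncated by
    clamp d, so that every iterate is B-Lipschitz on the whole line and its
    image under F has an antiderivative; the constant B passes to the pointwise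
    limit, which is therefore continuous too. *)
Lemma picard_lipschitz (R : realType) m (F : 'rV[R]_m -> 'rV[R]_m) (B L : R)
    (y0 : 'rV[R]_m) :
  (forall w, `|F w| <= B) -> (forall w w', `|F w - F w'| <= L * `|w - w'|) ->
  0 <= L ->
  exists2 d : R, 0 < d & exists y : R -> 'rV[R]_m,
    [/\ y 0 = y0, (forall t, `|y t - y0| <= B * `|t|) &
      forall t : R, `|t| < d -> forall k,
        is_derive t 1 (fun s => y s 0 k) (F (y t) 0 k)].
Proof.
move=> bF lF L0; have B0 : 0 <= B by exact: le_trans (bF y0).
(* L + 1 makes d < 1, the range of the antiderivatives, also for small L. *)
pose d : R := (2 * (L + 1))^-1.
have d0 : 0 < d by rewrite invr_gt0 mulr_gt0// ltr_wpDl.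
have d1 : d < 1.
  by rewrite invf_lt1 ?mulr_gt0 ?ltr_wpDl//; lra.
have Ld : L * d <= 2^-1.
  rewrite /d invfM mulrCA ler_pdivrMl//.
  by rewrite divff// ler_pdivrMr ?ltr_wpDl// mul1r lerDl.
have cl1 t : `|clamp d t| < 1 by exact: le_lt_trans (clamp_norm _ (ltW d0)) d1.
have pI (phi : R -> R) : exists Phi : R -> R, continuous phi -> Phi 0 = 0 /\
    forall t : R, `|t| < 1 -> is_derive t 1 Phi (phi t).
  have [c|nc] := pselect (continuous phi); last by exists (fun=> 0) => /nc.
  by have [Phi P0 dP] := exists_antiderivative c; exists Phi.
have [I HI] := choice pI.
pose T (u : R -> 'rV[R]_m) (t : R) : 'rV[R]_m :=
  y0 + \row_k I (fun s => F (u s) 0 k) (clamp d t).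
pose good (u : R -> 'rV[R]_m) := forall t s : R, `|u t - u s| <= B * `|t - s|.
have goodF u k : good u -> continuous (fun s => F (u s) 0 k).
  move=> gu; apply: (@lipschitz_continuous _ _ (L * B)) => t s.
  have := coord_le_normr (F (u t) - F (u s)) k; rewrite !mxE => /le_trans; apply.
  by apply: le_trans (lF _ _) _; rewrite -mulrA ler_wpM2l.
have T0 u : good u -> T u 0 = y0.
  move=> gu; apply/rowP => k; rewrite !mxE clamp_id ?normr0 ?ltW//.
  by have [-> _] := HI _ (goodF u k gu); rewrite addr0.
have goodT u : good u -> good (T u).
  move=> gu t s; apply/rowv_normr_leP; first by rewrite mulr_ge0.
  move=> k; rewrite !mxE opprD addrACA subrr add0r.
  have [_ dI] := HI _ (goodF u k gu).
  have bI (x : R) : `|F (u x) 0 k| <= B by exact: le_trans (coord_le_normr _ _) _.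
  apply: le_trans (derive_bound_lipschitz dI bI (cl1 t) (cl1 s)) _.
  by rewrite ler_wpM2l// clamp_lipschitz.
have contr u v c : good u -> good v -> (forall t, `|u t - v t| <= c) ->
    forall t, `|T u t - T v t| <= c / 2.
  move=> gu gv uv t; have c0 : 0 <= c by exact: le_trans (uv 0).
  apply/rowv_normr_leP; first by rewrite divr_ge0.
  move=> k; rewrite !mxE opprD addrACA subrr add0r.
  have [Iu0 dIu] := HI _ (goodF u k gu); have [Iv0 dIv] := HI _ (goodF v k gv).
  have dI (x : R) : `|x| < 1 ->
      is_derive x 1 (I (fun s => F (u s) 0 k) - I (fun s => F (v s) 0 k))
        (F (u x) 0 k - F (v x) 0 k).
    by move=> x1; apply: is_deriveB; [exact: dIu|exact: dIv].
  have bI (x : R) : `|F (u x) 0 k - F (v x) 0 k| <= L * c.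
    have := coord_le_normr (F (u x) - F (v x)) k.
    rewrite !mxE => /le_trans; apply; apply: le_trans (lF _ _) _.
    by rewrite ler_wpM2l.
  have z1 : `|0 : R| < 1 by rewrite normr0.
  have := derive_bound_lipschitz dI bI (cl1 t) z1.
  rewrite -![(_ - _ : _ -> _) _]/(_ - _)/= Iu0 Iv0 !subr0 => /le_trans; apply.
  apply: (@le_trans _ _ (L * c * d)).
    by rewrite ler_wpM2l ?mulr_ge0// clamp_norm// ltW.
  by rewrite mulrAC mulrC ler_wpM2l.
pose u n := iter n T (fun=> y0).
have gu n : good (u n).
  elim: n => [|n IH]; last exact: goodT.
  by move=> t s; rewrite /u/= subrr normr0 mulr_ge0.
have uS n t : `|u n.+1 t - u n t| <= B / 2 ^+ n.
  elim: n t => [|n IH] t.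
    rewrite expr0 divr1; apply/rowv_normr_leP => // k.
    rewrite -[u 0%N t]/y0 !mxE addrAC subrr add0r.
    have [I0 dI] := HI _ (goodF (u 0%N) k (gu 0%N)).
    have bI (x : R) : `|F (u 0%N x) 0 k| <= B by exact: le_trans (coord_le_normr _ _) _.
    have z1 : `|0 : R| < 1 by rewrite normr0.
    have := derive_bound_lipschitz dI bI (cl1 t) z1.
    rewrite I0 !subr0 => /le_trans; apply.
    by rewrite ler_piMr// ltW.
  by rewrite exprSr invfM mulrA; exact: contr (gu n.+1) (gu n) IH t.
have lim_u t : exists l : 'rV[R]_m, forall n, `|u n t - l| <= 2 * B / 2 ^+ n.
  have lk k : exists l, forall n, `|u n t 0 k - l| <= 2 * B / 2 ^+ n.
    apply: geometric_increments_limit => n.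
    by have := coord_le_normr (u n.+1 t - u n t) k; rewrite !mxE => /le_trans; apply.
  have [l lP] := choice lk; exists (\row_k l k) => n.
  apply/rowv_normr_leP => [|k]; last by rewrite !mxE.
  by rewrite divr_ge0 ?exprn_ge0// mulr_ge0.
have [y yP] := choice lim_u.
have gy : good y.
  move=> t s; apply: (@ler_geometric_limit _ (4 * B)) => n.
  have -> : y t - y s = (u n t - u n s) + (- (u n t - y t) + (u n s - y s)).
    by apply/rowP => j; rewrite !mxE; ring.
  have : 4 * B / 2 ^+ n = 2 * B / 2 ^+ n + 2 * B / 2 ^+ n by ring.
  move=> ->; apply: le_trans (ler_normD _ _) _; apply: lerD; first exact: gu.
  by apply: le_trans (ler_normD _ _) _; rewrite normrN; apply: lerD; exact: yP.
have fixy t : y t = T y t.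
  apply/eqP; rewrite -subr_eq0 -normr_le0.
  apply: (@ler_geometric_limit _ (2 * B)) => n; rewrite add0r.
  have -> : y t - T y t = - (u n.+1 t - y t) + (T (u n) t - T y t).
    by rewrite opprB addrA subrK.
  have : 2 * B / 2 ^+ n = 2 * B / 2 ^+ n.+1 + (2 * B / 2 ^+ n) / 2.
    by rewrite exprS; field; rewrite expf_neq0.
  move=> ->; apply: le_trans (ler_normD _ _) _; rewrite normrN.
  by apply: lerD; [exact: yP|apply: contr => // s; exact: yP].
have y00 : y 0 = y0 by rewrite fixy T0.
exists d => //; exists y; split=> // [t|t td k].
  by have := gy t 0; rewrite y00 subr0.
have [_ dI] := HI _ (goodF y k gy).
have := is_deriveD (is_derive_cst (y0 0 k) t 1) (dI t (lt_trans td d1)).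
rewrite add0r; apply: near_eq_is_derive.
near=> s; rewrite [in RHS]fixy !mxE clamp_id//.
by apply: ltW; near: s; exact: near_normr_lt.
Unshelve. all: by end_near. Qed.

(** Precomposing F with the projection P onto the box of half the radius gives a
    bounded, globally Lipschitz field. A solution for this field moves with
    bounded speed, hence stays for a while in the box, where P is the identity. *)
Lemma local_ode_solution (R : realType) m (F : 'rV[R]_m -> 'rV[R]_m)
    (y0 : 'rV[R]_m) (r L : R) :
  0 < r ->
  (forall w w', ball y0 r w -> ball y0 r w' ->
     forall k, `|F w 0 k - F w' 0 k| <= L * `|w - w'|) ->
  exists2 d : R, 0 < d & exists2 y : R -> 'rV[R]_m, y 0 = y0 &
    forall t : R, `|t| < d -> ball y0 r (y t) /\
      forall k, is_derive t 1 (fun s => y s 0 k) (F (y t) 0 k).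
Proof.
move=> r0 lF; pose r2 := r / 2.
have r20 : 0 < r2 by rewrite divr_gt0.
have r2r : r2 < r by rewrite /r2 ltr_pdivrMr// mulr2n mulrDr mulr1 ltrDl.
pose P (w : 'rV[R]_m) : 'rV[R]_m := \row_k (y0 0 k + clamp r2 (w 0 k - y0 0 k)).
have Pball w : ball y0 r (P w).
  apply/rowv_ballP => // k; rewrite mxE opprD addNKr normrN.
  exact: le_lt_trans (clamp_norm _ (ltW r20)) r2r.
have Plip w w' : `|P w - P w'| <= `|w - w'|.
  apply/rowv_normr_leP => // k; rewrite !mxE opprD addrACA subrr add0r.
  apply: le_trans (clamp_lipschitz _ _ _) _; rewrite opprB addrA subrK.
  by have := coord_le_normr (w - w') k; rewrite !mxE.
have Pid w : `|w - y0| <= r2 -> P w = w.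
  move=> wr; apply/rowP => k; rewrite mxE clamp_id; first by rewrite addrC subrK.
  by have := coord_le_normr (w - y0) k; rewrite !mxE => /le_trans; apply.
have L0 : 0 <= `|L| by [].
have lFP w w' : `|F (P w) - F (P w')| <= `|L| * `|w - w'|.
  apply/rowv_normr_leP => [|k]; first by rewrite mulr_ge0.
  rewrite !mxE; apply: le_trans (lF _ _ (Pball w) (Pball w') k) _.
  apply: (@le_trans _ _ (`|L| * `|P w - P w'|)); first by rewrite ler_wpM2r// ler_norm.
  by rewrite ler_wpM2l.
pose B := `|F y0| + `|L| * r.
have bFP w : `|F (P w)| <= B.
  have -> : F (P w) = F y0 + (F (P w) - F y0) by rewrite addrC subrK.
  apply: le_trans (ler_normD _ _) _; rewrite lerD2l.
  apply/rowv_normr_leP => [|k]; first by rewrite mulr_ge0// ltW.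
  rewrite !mxE; apply: le_trans (lF _ _ (Pball w) (ballxx _ r0) k) _.
  apply: (@le_trans _ _ (`|L| * `|P w - y0|)); first by rewrite ler_wpM2r// ler_norm.
  rewrite ler_wpM2l//; apply/rowv_normr_leP => [|j]; first exact: ltW.
  rewrite !mxE addrAC subrr add0r.
  exact: le_trans (clamp_norm _ (ltW r20)) (ltW r2r).
have [d d0 [y [y00 yB dy]]] := @picard_lipschitz R m (F \o P) B `|L| y0 bFP lFP L0.
have B1 : 0 < B + 1 by rewrite ltr_wpDl// (le_trans _ (bFP y0)).
exists (Num.min d (r2 / (B + 1))); first by rewrite lt_min d0 divr_gt0.
exists y => // t; rewrite lt_min => /andP[td tr].
have yr : `|y t - y0| <= r2.
  apply: le_trans (yB t) _.
  apply: (@le_trans _ _ ((B + 1) * `|t|)); first by rewrite ler_wpM2r// lerDl.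
  by rewrite -ler_pdivlMl// mulrC ltW.
split; first by rewrite -(Pid _ yr); exact: Pball.
by move=> k; have := dy t td k; rewrite /= Pid.
Qed.

(** * Local Lipschitz continuity *)

Definition locally_lipschitz (R : realType) n (h : 'rV[R]_n -> R) (y : 'rV[R]_n) :=
  exists2 r : R, 0 < r & exists2 L : R, 0 <= L &
    forall w w', ball y r w -> ball y r w' -> `|h w - h w'| <= L * `|w - w'|.

Section LocallyLipschitz.
Variables (R : realType) (n : nat) (y : 'rV[R]_n).

Lemma locally_lipschitz_cst (a : R) : locally_lipschitz (fun=> a) y.
Proof.
by exists 1 => //; exists 0 => // w w' _ _; rewrite subrr normr0 mul0r.
Qed.

Lemma locally_lipschitz_coord k : locally_lipschitz (fun w : 'rV[R]_n => w 0 k) y.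
Proof.
exists 1 => //; exists 1 => // w w' _ _; rewrite mul1r.
by have := coord_le_normr (w - w') k; rewrite !mxE.
Qed.

Lemma locally_lipschitzD h h' : locally_lipschitz h y -> locally_lipschitz h' y ->
  locally_lipschitz (fun w => h w + h' w) y.
Proof.
move=> [r r0 [L L0 hL]] [r' r'0 [L' L'0 h'L]].
exists (Num.min r r'); first by rewrite lt_min r0.
exists (L + L') => [|w w' yw yw']; first exact: addr_ge0.
rewrite opprD addrACA mulrDl; apply: le_trans (ler_normD _ _) _; apply: lerD.
  by apply: hL; [apply: le_ball yw|apply: le_ball yw']; rewrite ge_min lexx.
by apply: h'L; [apply: le_ball yw|apply: le_ball yw']; rewrite ge_min lexx orbT.
Qed.

(** On the ball of radius s, each factor is bounded by its value at the centre
    plus its Lipschitz constant times s. *)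
Lemma locally_lipschitzM h h' : locally_lipschitz h y -> locally_lipschitz h' y ->
  locally_lipschitz (fun w => h w * h' w) y.
Proof.
move=> [r r0 [L L0 hL]] [r' r'0 [L' L'0 h'L]]; pose s := Num.min r r'.
have s0 : 0 < s by rewrite lt_min r0.
have bnd (g : 'rV[R]_n -> R) K w : 0 <= K ->
    `|g w - g y| <= K * `|w - y| -> ball y s w -> `|g w| <= `|g y| + K * s.
  move=> K0 gK; rewrite -ball_normE/= /ball_/= distrC => /ltW ws.
  rewrite -(subrK (g y) (g w)) addrC; apply: le_trans (ler_normD _ _) _.
  by rewrite lerD2l; apply: le_trans gK _; rewrite ler_wpM2l.
have sr : s <= r by rewrite ge_min lexx.
have sr' : s <= r' by rewrite ge_min lexx orbT.
exists s => //; exists (L * (`|h' y| + L' * s) + (`|h y| + L * s) * L').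
  by have s0' := ltW s0; rewrite !(addr_ge0, mulr_ge0).
move=> w w' yw yw'.
have -> : h w * h' w - h w' * h' w' = (h w - h w') * h' w + h w' * (h' w - h' w').
  by ring.
apply: le_trans (ler_normD _ _) _; rewrite !normrM mulrDl; apply: lerD.
  rewrite mulrAC; apply: ler_pM => //.
    by apply: hL; [apply: le_ball yw|apply: le_ball yw'].
  by apply: bnd => //; apply: h'L; [apply: le_ball yw|exact: ballxx].
rewrite -mulrA; apply: ler_pM => //.
  by apply: bnd => //; apply: hL; [apply: le_ball yw'|exact: ballxx].
by apply: h'L; [apply: le_ball yw|apply: le_ball yw'].
Qed.

Lemma locally_lipschitz_sum (I : finType) (h : I -> 'rV[R]_n -> R) :
  (forall i, locally_lipschitz (h i) y) ->
  locally_lipschitz (fun w => \sum_i h i w) y.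
Proof.
move=> H; elim: (index_enum I) => [|i s IH].
  under [fun w => _]funext => w do rewrite big_nil.
  exact: locally_lipschitz_cst.
under [fun w => _]funext => w do rewrite big_cons.
exact: locally_lipschitzD.
Qed.

Lemma locally_lipschitz_family (F : 'I_n -> 'rV[R]_n -> R) :
  (forall k, locally_lipschitz (F k) y) ->
  exists2 r : R, 0 < r & exists L : R, forall w w', ball y r w -> ball y r w' ->
    forall k, `|F k w - F k w'| <= L * `|w - w'|.
Proof.
move=> H.
have Q k : exists rL : R * R, [/\ 0 < rL.1, 0 <= rL.2 &
    forall w w', ball y rL.1 w -> ball y rL.1 w' ->
    `|F k w - F k w'| <= rL.2 * `|w - w'|].
  by have [r r0 [L L0 hL]] := H k; exists (r, L).
have [rL rLP] := choice Q.
exists (\big[Num.min/1]_k (rL k).1).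
  by apply: lt_bigmin => // k _; case: (rLP k).
exists (\sum_k (rL k).2) => w w' yw yw' k; have [r0 L0 hL] := rLP k.
have rk : \big[Num.min/1]_k (rL k).1 <= (rL k).1 by exact: bigmin_le.
apply: (@le_trans _ _ ((rL k).2 * `|w - w'|)).
  by apply: hL; [apply: le_ball yw|apply: le_ball yw'].
rewrite ler_wpM2r// (bigD1 k)//= lerDl sumr_ge0// => j _.
by case: (rLP j).
Qed.

End LocallyLipschitz.

Lemma locally_lipschitz_lsubmx (R : realType) n m (h : 'rV[R]_n -> R)
    (w : 'rV[R]_(n + m)) :
  locally_lipschitz h (lsubmx w) -> locally_lipschitz (fun w => h (lsubmx w)) w.
Proof.
move=> [r r0 [L L0 hL]]; exists r => //; exists L => // u u' wu wu'.
have B z : ball w r z -> ball (lsubmx w) r (lsubmx z).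
  move=> /(rowv_ballP _ _ r0) H; apply/(rowv_ballP _ _ r0) => k.
  by rewrite !mxE.
apply: le_trans (hL _ _ (B _ wu) (B _ wu')) _; rewrite ler_wpM2l//.
apply/rowv_normr_leP => // k; rewrite !mxE.
by have := coord_le_normr (u - u') (lshift m k); rewrite !mxE.
Qed.

(** The partial derivatives are continuous, hence bounded near y, and the mean
    value theorem applies in a ball. *)
Lemma smooth_on_locally_lipschitz (R : realType) n (U : set 'rV[R]_n)
    (h : 'rV[R]_n -> R) (y : 'rV[R]_n) :
  open U -> smooth_on U h -> U y -> locally_lipschitz h y.
Proof.
move=> oU sh Uy.
have : \forall z \near y, forall i,
    derivable h z (delta_mx 0 i) /\ `|partial i h z| <= `|partial i h y| + 1.
  near=> z => i; split.
    have Uz : U z by near: z; exact: open_nbhs_nbhs.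
    by have [_] := sh [::] z Uz; apply.
  move: i; near: z; apply: filter_forall => i.
  have [ci _] := sh [:: i] y Uy.
  move: ci => /cvgrPdist_le/(_ 1 ltr01); apply: filterS => z yz.
  rewrite -{1}(subrK (partial i h y) (partial i h z)) addrC.
  by apply: le_trans (ler_normD _ _) _; rewrite lerD2l distrC.
move=> /nbhs_ballP[r/= r0 Hr]; exists r => //.
exists (\sum_i (`|partial i h y| + 1)).
  by apply: sumr_ge0 => i _; rewrite addr_ge0.
move=> w w' yw yw'.
have [|xi yxi ->] := @mean_value_ball R n h y r _ w w' yw yw'.
  by move=> z /Hr/[swap] i /(_ i)[].
apply: le_trans (ler_norm_sum _ _ _) _; rewrite mulr_suml; apply: ler_sum => i _.
rewrite normrM mulrC; apply: ler_pM => //; first by have [] := Hr _ (yxi i) i.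
by have := coord_le_normr (w - w') i; rewrite !mxE.
Unshelve. all: by end_near. Qed.

(** * Iterated derivatives on an open set of times *)

Section IteratedDerivatives.
Variables (R : realType) (J : set R).
Hypothesis oJ : open J.

(** Being l times differentiable on J. Continuity of the last derivative is left
    out: smoothness is the case of all l, where it follows. *)
Fixpoint Ck_on (l : nat) (phi : R -> R) : Prop :=
  if l is l'.+1 then (forall t, J t -> derivable phi t 1) /\ Ck_on l' (derive1 phi)
  else True.

Lemma near_eq_on (phi psi : R -> R) t :
  (forall s, J s -> phi s = psi s) -> J t -> \forall s \near t, phi s = psi s.
Proof. by move=> E Jt; apply: filterS (open_nbhs_nbhs (conj oJ Jt)). Qed.

Lemma derive1_eq_on (phi psi : R -> R) t :
  (forall s, J s -> phi s = psi s) -> J t -> derive1 phi t = derive1 psi t.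
Proof.
move=> E Jt; rewrite !derive1E; apply: near_eq_derive; exact: near_eq_on.
Qed.

Lemma Ck_on_eq l (phi psi : R -> R) :
  (forall s, J s -> phi s = psi s) -> Ck_on l phi -> Ck_on l psi.
Proof.
elim: l phi psi => //= l IH phi psi E [dphi Cphi]; split.
  by move=> t Jt; apply: near_eq_derivable (dphi t Jt); exact: near_eq_on.
by apply: IH Cphi => s Js; exact: derive1_eq_on.
Qed.

Lemma Ck_onW l phi : Ck_on l.+1 phi -> Ck_on l phi.
Proof.
elim: l phi => // l IH phi [dphi Cphi]; split => //; exact: IH.
Qed.

Lemma Ck_on_cst l (a : R) : Ck_on l (fun=> a).
Proof.
elim: l a => //= l IH a; split=> [t _|]; first exact: derivable_cst.
by apply: Ck_on_eq (IH 0) => s _; rewrite derive1_cst.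
Qed.

Lemma Ck_onD l phi psi : Ck_on l phi -> Ck_on l psi -> Ck_on l (fun t => phi t + psi t).
Proof.
elim: l phi psi => //= l IH phi psi [dphi Cphi] [dpsi Cpsi].
split=> [t Jt|]; first by apply: derivableD; [exact: dphi|exact: dpsi].
apply: Ck_on_eq (IH _ _ Cphi Cpsi) => s Js; rewrite !derive1E.
by rewrite [RHS]deriveD//; [exact: dphi|exact: dpsi].
Qed.

Lemma Ck_onM l phi psi : Ck_on l phi -> Ck_on l psi -> Ck_on l (fun t => phi t * psi t).
Proof.
elim: l phi psi => //= l IH phi psi [dphi Cphi] [dpsi Cpsi].
split=> [t Jt|]; first by apply: derivableM; [exact: dphi|exact: dpsi].
have Cphi' : Ck_on l phi by apply: Ck_onW.
have Cpsi' : Ck_on l psi by apply: Ck_onW.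
apply: Ck_on_eq (Ck_onD (IH _ _ Cphi' Cpsi) (IH _ _ Cpsi' Cphi)) => s Js.
rewrite !derive1E [RHS]deriveM//; [exact: dphi|exact: dpsi].
Qed.

Lemma Ck_on_sum l (I : finType) (phi : I -> R -> R) :
  (forall i, Ck_on l (phi i)) -> Ck_on l (fun t => \sum_i phi i t).
Proof.
move=> H; elim: (index_enum I) => [|i s IH].
  under [fun w => _]funext => w do rewrite big_nil.
  exact: Ck_on_cst.
under [fun w => _]funext => w do rewrite big_cons.
exact: Ck_onD.
Qed.

(** The derivative of h along x is the sum of the x_i' times the partial
    derivatives of h along x; the latter are again smooth functions along x, so
    the induction on l runs over all h simultaneously. *)
Lemma Ck_on_comp l n (U : set 'rV[R]_n) (x : R -> 'rV[R]_n) (h : 'rV[R]_n -> R) :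
  open U -> (forall t, J t -> U (x t)) -> smooth_on U h ->
  (forall k, Ck_on l (fun t => x t 0 k)) -> Ck_on l (fun t => h (x t)).
Proof.
move=> oU xU; elim: l h => //= l IH h sh Cx.
have dh t : J t -> is_derive t 1 (h \o x)
    (\sum_i derive1 (fun s => x s 0 i) t * partial i h (x t)).
  move=> Jt; apply: is_derive_chain => [|k]; last by have [dx _] := Cx k; exact: dx.
  exact: smooth_on_differentiable (xU t Jt).
split=> [t Jt|]; first by case: (dh t Jt).
apply: (@Ck_on_eq _ (fun t => \sum_i derive1 (fun s => x s 0 i) t * partial i h (x t))).
  by move=> s Js; rewrite derive1E; case: (dh s Js).
apply: Ck_on_sum => i; apply: Ck_onM; first by case: (Cx i).
by apply: IH => [|k]; [exact: smooth_on_partial|exact/Ck_onW/Cx].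
Qed.

Lemma Ck_onP phi :
  (forall l, Ck_on l phi) <-> forall t, J t -> forall l, derivable (derive1n l phi) t 1.
Proof.
split=> [H t Jt l|H l].
  have := H l.+1; elim: l {H} phi => [|l IH] phi /=; first by case=> d _; exact: d.
  by case=> _ /IH; rewrite -derive1Sn.
elim: l phi H => //= l IH phi H; split=> [t Jt|]; first exact: (H t Jt 0%N).
by apply: IH => t Jt l'; rewrite -derive1Sn; exact: H.
Qed.

End IteratedDerivatives.

(** * Local solutions of second-order equations *)

(** The first-order system for w = (x, v) with x' = v. Its right-hand side is
    Lipschitz near the initial point because the C h i j are. Smoothness is
    gained one derivative at a time: v' is a polynomial in v whose coefficients
    are smooth functions along x, so it is as regular as x and v together. *)
Lemma local_second_order_solution (R : realType) n (U : set 'rV[R]_n)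
    (C : 'I_n -> 'I_n -> 'I_n -> 'rV[R]_n -> R) (x0 v0 : 'rV[R]_n) :
  open U -> U x0 -> (forall h i j, smooth_on U (C h i j)) ->
  exists2 d : R, 0 < d & exists x : R -> 'rV[R]_n,
    [/\ x 0 = x0, (forall k, derive1 (fun s => x s 0 k) 0 = v0 0 k) &
      forall t : R, `|t| < d ->
        [/\ U (x t),
          (forall k l, derivable (derive1n l (fun s => x s 0 k)) t 1) &
          forall h, derive1n 2 (fun s => x s 0 h) t +
            \sum_i \sum_j C h i j (x t) * derive1 (fun s => x s 0 i) t *
                          derive1 (fun s => x s 0 j) t = 0]].
Proof.
move=> oU Ux0 sC.
pose acc h (w : 'rV[R]_(n + n)) := \sum_i \sum_j
  - (C h i j (lsubmx w) * w 0 (rshift n i) * w 0 (rshift n j)).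
pose F (w : 'rV[R]_(n + n)) : 'rV[R]_(n + n) := row_mx (rsubmx w) (\row_h acc h w).
pose w0 := row_mx x0 v0.
have lF k : locally_lipschitz (fun w => F w 0 k) w0.
  rewrite -(splitK k) /unsplit; case: (fintype.split k) => h; rewrite /F.
    under [fun w => _]funext => w do rewrite row_mxEl mxE.
    exact: locally_lipschitz_coord.
  under [fun w => _]funext => w do rewrite row_mxEr mxE.
  apply: locally_lipschitz_sum => i; apply: locally_lipschitz_sum => j.
  under [fun w => _]funext => w do rewrite -mulN1r.
  apply: locally_lipschitzM; first exact: locally_lipschitz_cst.
  apply: locally_lipschitzM; last exact: locally_lipschitz_coord.
  apply: locally_lipschitzM; last exact: locally_lipschitz_coord.
  apply: locally_lipschitz_lsubmx; rewrite row_mxKl.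
  exact: smooth_on_locally_lipschitz Ux0.
have [r1 r10 [L HL]] := locally_lipschitz_family lF.
have /nbhs_ballP[r2/= r20 r2U] : nbhs x0 U by exact: open_nbhs_nbhs.
pose r := Num.min r1 r2.
have r0 : 0 < r by rewrite lt_min r10.
have [|d d0 [y y0 Hy]] := @local_ode_solution R _ F w0 r L r0.
  move=> w w' yw yw' k; apply: HL; [apply: le_ball yw|apply: le_ball yw'];
  by rewrite ge_min lexx.
pose J := [set t : R | `|t| < d].
have oJ : open J.
  rewrite openE => t Jt; exact: near_normr_lt.
pose x t := lsubmx (y t); pose v (k : 'I_n) (t : R) := y t 0 (rshift n k).
have xU t : J t -> U (x t).
  move=> Jt; apply: r2U; have [yt _] := Hy t Jt.
  apply/rowv_ballP => // k; rewrite mxE.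
  move: yt => /(rowv_ballP _ _ r0)/(_ (lshift n k)); rewrite row_mxEl.
  by move=> /lt_le_trans; apply; rewrite ge_min lexx orbT.
have dx t k : J t -> is_derive t 1 (fun s => x s 0 k) (v k t).
  move=> Jt; have [_ /(_ (lshift n k))] := Hy t Jt.
  rewrite /F row_mxEl mxE /x; congr (is_derive _ _ _ _).
  by apply/funext => s; rewrite mxE.
have dv t k : J t -> is_derive t 1 (v k) (acc k (y t)).
  by move=> Jt; have [_ /(_ (rshift n k))] := Hy t Jt; rewrite /F row_mxEr mxE.
have d1x t k : J t -> derive1 (fun s => x s 0 k) t = v k t.
  by move=> Jt; rewrite derive1E; case: (dx t k Jt).
have smooth l : (forall k, Ck_on J l (fun s => x s 0 k)) /\ (forall k, Ck_on J l (v k)).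
  elim: l => [//|l [IHx IHv]]; split=> k /=; split=> [t Jt|].
  - by case: (dx t k Jt).
  - by apply: Ck_on_eq (IHv k) => // s Js; rewrite d1x.
  - by case: (dv t k Jt).
  - apply: (@Ck_on_eq _ _ _ _ (fun t => acc k (y t))) => // [s Js|].
      by rewrite derive1E; case: (dv s k Js).
    apply: Ck_on_sum => // i; apply: Ck_on_sum => // j.
    under [fun w => _]funext => w do rewrite -mulN1r.
    apply: Ck_onM => //; first exact: Ck_on_cst.
    apply: (Ck_onM oJ _ (IHv j)); apply: (Ck_onM oJ _ (IHv i)).
    exact: (Ck_on_comp oJ oU xU).
exists d => //; exists x; split=> [|k|t td].
- by rewrite /x y0 row_mxKl.
- by rewrite d1x ?/J/= ?normr0// /v y0 row_mxEr.
split; first exact: xU.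
  by move=> k l; apply: (Ck_onP J (fun s => x s 0 k)).1 => // l'; case: (smooth l').
move=> h.
set D2 := derive1 (derive1 _) t; have -> : D2 = acc h (y t).
  rewrite /D2 (@derive1_eq_on _ J oJ _ (v h) t (fun s => d1x s h))//.
  by rewrite derive1E; case: (dv t h td).
rewrite -big_split big1//= => i _; rewrite -big_split big1//= => j _.
by rewrite !d1x// addrC subrr.
Qed.

(** * The covariant derivative of tensors in matrix form *)

Lemma differentiable_bigsum (R : realType) (V : normedModType R) (I : finType)
    (F : I -> V -> R) (y : V) :
  (forall i, differentiable (F i) y) -> differentiable (fun z => \sum_i F i z) y.
Proof.
move=> dF; elim: (index_enum I) => [|i s IH].
  under [fun w => _]funext => w do rewrite big_nil.
  exact: differentiable_cst.
under [fun w => _]funext => w do rewrite big_cons.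
exact: differentiableD.
Qed.

Lemma is_derive_bigsum (R : realType) (V : normedModType R) (I : finType)
    (F : I -> V -> R) (dF : I -> R) (y v : V) :
  (forall i, is_derive y v (F i) (dF i)) ->
  is_derive y v (fun z => \sum_i F i z) (\sum_i dF i).
Proof.
move=> H; elim: (index_enum I) => [|i s IH].
  under [fun w => _]funext => w do rewrite big_nil.
  by rewrite big_nil; exact: is_derive_cst.
under [fun w => _]funext => w do rewrite big_cons.
by rewrite big_cons; exact: is_deriveD.
Qed.

Lemma is_derive_coord (R : realType) n (w W : 'rV[R]_n) k :
  is_derive w W (fun z : 'rV[R]_n => z 0 k) (W 0 k).
Proof.
split; first exact/diff_derivable/differentiable_coord.
have := derive_id w W; rewrite derive_mx; last exact: derivable_id.
by move=> /rowP/(_ k); rewrite mxE.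
Qed.

Lemma is_derive_lsubmx (R : realType) n m (h : 'rV[R]_n -> R)
    (w W : 'rV[R]_(n + m)) (d : R) :
  is_derive (lsubmx w) (lsubmx W) h d ->
  is_derive w W (fun z => h (lsubmx z)) d.
Proof.
have E : (fun e : R => e^-1 *: ((h \o shift (lsubmx w)) (e *: lsubmx W) - h (lsubmx w)))
  = (fun e : R => e^-1 *: (((fun z => h (lsubmx z)) \o shift w) (e *: W) -
                       h (lsubmx w))).
  apply/funext => e /=; congr (_ *: (h _ - _)).
  by apply/rowP => j; rewrite !mxE.
by case=> dh <-; split; rewrite /derivable /derive -E.
Qed.

Section TensorDerivative.
Variables (R : realType) (n : nat) (M : atlas R n) (p q : nat).
Variable D : connection M.

Local Notation K := (tdim n p q).

Fact gam_act_is_linear a s y :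
  linear (@gam_act R n M p q D a s y).
Proof.
move=> k t t'; apply/rowP => e; rewrite !mxE /tcoef.
rewrite mulrBr !mulr_sumr addrACA -opprD -!big_split/=.
congr (_ - _); apply: eq_bigr => l _; rewrite mulr_sumr -big_split/=;
  by apply: eq_bigr => m _; rewrite !mxE mulrDr mulrCA.
Qed.
HB.instance Definition _ a s y := GRing.isLinear.Build R 'rV[R]_K 'rV[R]_K _
  (@gam_act R n M p q D a s y) (gam_act_is_linear a s y).

(** The zeroth-order part of the covariant derivative is linear in the tensor.
    Writing it as a multiplication on the right by a matrix makes the
    computations below matrix algebra. *)
Definition gam_mx (a : chart M) (s : 'I_n) (y : 'rV[R]_n) : 'M[R]_K :=
  lin1_mx (@gam_act R n M p q D a s y).

Lemma gam_act_mulmx a s y (t : 'rV[R]_K) : gam_act D a s y t = t *m gam_mx a s y.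
Proof. by rewrite mul_rV_lin1. Qed.

Lemma differentiable_gam_mx a s y i j : open (chart_img a) -> chart_img a y ->
  differentiable (fun z => gam_mx a s z i j) y.
Proof.
move=> oa ay; under [fun w => _]funext => w do rewrite !mxE.
have dg h k l c : differentiable (fun z => gam D a h k l z * c) y.
  apply: differentiableM; last exact: differentiable_cst.
  exact: smooth_on_differentiable (@gam_smooth _ _ _ D a h k l) ay.
by apply: differentiableB; apply: differentiable_bigsum => l;
  apply: differentiable_bigsum => m; exact: dg.
Qed.

(** The zeroth-order part of nabla_v. *)
Definition gam_dir (a : chart M) (v y : 'rV[R]_n) : 'M[R]_K :=
  \sum_s v 0 s *: gam_mx a s y.

(** The derivative of gam_dir a v in the direction u, for v fixed. *)
Definition dgam_dir (a : chart M) (u v y : 'rV[R]_n) : 'M[R]_K :=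
  \sum_s v 0 s *: \matrix_(i, j) 'D_u (fun z => gam_mx a s z i j) y.

Lemma gam_dir_entry a (v y : 'rV[R]_n) i j :
  gam_dir a v y i j = \sum_s v 0 s * gam_mx a s y i j.
Proof. by rewrite summxE; apply: eq_bigr => s _; rewrite mxE. Qed.

Lemma dgam_dir_entry a (u v y : 'rV[R]_n) i j :
  dgam_dir a u v y i j = \sum_s v 0 s * 'D_u (fun z => gam_mx a s z i j) y.
Proof. by rewrite summxE; apply: eq_bigr => s _; rewrite !mxE. Qed.

Lemma gam_dirE a (v y : 'rV[R]_n) (t : 'rV[R]_K) :
  \sum_s v 0 s *: gam_act D a s y t = t *m gam_dir a v y.
Proof.
rewrite mulmx_sumr; apply: eq_bigr => s _.
by rewrite gam_act_mulmx scalemxAr.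
Qed.

Lemma gam_dir_sum a (I : finType) (c : I -> R) (v : I -> 'rV[R]_n) y :
  gam_dir a (\sum_i c i *: v i) y = \sum_i c i *: gam_dir a (v i) y.
Proof.
rewrite /gam_dir; under [RHS]eq_bigr do rewrite scaler_sumr.
rewrite exchange_big; apply: eq_bigr => s _ /=.
rewrite summxE scaler_suml; apply: eq_bigr => i _.
by rewrite mxE scalerA.
Qed.

Lemma dgam_dir0 a v y : dgam_dir a 0 v y = 0.
Proof.
rewrite /dgam_dir big1// => s _; rewrite [X in _ *: X](_ : _ = 0) ?scaler0//.
by apply/matrixP => i j; rewrite !mxE derive0.
Qed.

(** The product rule for the fibre component of a horizontal lift, up to sign. *)
Lemma is_derive_gam_dir a (t u : 'rV[R]_K) (y v0 v : 'rV[R]_n) k :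
  open (chart_img a) -> chart_img a y ->
  is_derive (row_mx y t) (row_mx v u)
    (fun w => (rsubmx w *m gam_dir a v0 (lsubmx w)) 0 k)
    ((u *m gam_dir a v0 y + t *m dgam_dir a v v0 y) 0 k).
Proof.
move=> oa ay.
have E : (fun w : 'rV[R]_(n + K) => (rsubmx w *m gam_dir a v0 (lsubmx w)) 0 k) =
  (fun w => \sum_j w 0 (rshift n j) * \sum_s v0 0 s * gam_mx a s (lsubmx w) j k).
  apply/funext => w; rewrite mxE; apply: eq_bigr => j _.
  by rewrite mxE gam_dir_entry.
rewrite E.
have dg j : is_derive (row_mx y t) (row_mx v u)
    (fun w => \sum_s v0 0 s * gam_mx a s (lsubmx w) j k)
    (\sum_s v0 0 s * 'D_v (fun z => gam_mx a s z j k) y).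
  apply: is_derive_bigsum => s.
  have /derivableP dgs : derivable (fun z => gam_mx a s z j k) y v.
    exact/diff_derivable/differentiable_gam_mx.
  have dl : is_derive (row_mx y t) (row_mx v u)
      (fun w => gam_mx a s (lsubmx w) j k) ('D_v (fun z => gam_mx a s z j k) y).
    by apply: (@is_derive_lsubmx _ _ _ (fun z => gam_mx a s z j k)); rewrite !row_mxKl.
  have := is_deriveM (is_derive_cst (v0 0 s) (row_mx y t) (row_mx v u)) dl.
  by move/is_derive_eq; apply; rewrite scaler0 addr0.
have dj j := is_deriveM (is_derive_coord (row_mx y t) (row_mx v u) (rshift n j)) (dg j).
apply: (is_derive_eq (is_derive_bigsum dj)).
rewrite !mxE -big_split/=; apply: eq_bigr => j _.
rewrite !row_mxEr row_mxKl /GRing.scale/= addrC.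
congr (_ + _); first by rewrite dgam_dir_entry.
by rewrite gam_dir_entry mulrC.
Qed.

Lemma differentiable_gam_dir a (w : 'rV[R]_(n + K)) v0 k :
  open (chart_img a) -> chart_img a (lsubmx w) ->
  differentiable (fun w => (rsubmx w *m gam_dir a v0 (lsubmx w)) 0 k) w.
Proof.
move=> oa ay.
have E : (fun w : 'rV[R]_(n + K) => (rsubmx w *m gam_dir a v0 (lsubmx w)) 0 k) =
  (fun w => \sum_j w 0 (rshift n j) * \sum_s v0 0 s * gam_mx a s (lsubmx w) j k).
  apply/funext => z; rewrite mxE; apply: eq_bigr => j _.
  by rewrite mxE gam_dir_entry.
rewrite E; apply: differentiable_bigsum => j.
apply: differentiableM; first exact: differentiable_coord.
apply: differentiable_bigsum => s.
apply: differentiableM; first exact: differentiable_cst.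
apply: (@differentiable_comp _ _ _ _ (@lsubmx R 1 n K) (fun z => gam_mx a s z j k)).
  exact: differentiable_lsubmx.
exact: differentiable_gam_mx.
Qed.

End TensorDerivative.

(** * The quadratic form of the metric connection *)

Section ConnectionForm.
Variables (R : realType) (n : nat) (M : atlas R n) (D : connection M).

Definition conn_form (a : chart M) (y u v : 'rV[R]_n) : 'rV[R]_n :=
  \row_h \sum_i \sum_j gam D a h i j y * u 0 i * v 0 j.

Lemma conn_form_suml a y (I : finType) (c : I -> R) (u : I -> 'rV[R]_n) v :
  conn_form a y (\sum_k c k *: u k) v = \sum_k c k *: conn_form a y (u k) v.
Proof.
apply/rowP => h; rewrite mxE summxE.
under eq_bigr => i _ do under eq_bigr => j _ do
  rewrite summxE mulr_sumr mulr_suml.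
under eq_bigr => i _ do rewrite exchange_big.
rewrite exchange_big/=; apply: eq_bigr => k _; rewrite !mxE mulr_sumr.
apply: eq_bigr => i _; rewrite mulr_sumr; apply: eq_bigr => j _.
by rewrite !mxE; ring.
Qed.

Lemma conn_form_sumr a y (I : finType) (c : I -> R) u (v : I -> 'rV[R]_n) :
  conn_form a y u (\sum_k c k *: v k) = \sum_k c k *: conn_form a y u (v k).
Proof.
apply/rowP => h; rewrite mxE summxE.
under eq_bigr => i _ do under eq_bigr => j _ do rewrite summxE mulr_sumr.
under eq_bigr => i _ do rewrite exchange_big.
rewrite exchange_big/=; apply: eq_bigr => k _; rewrite !mxE mulr_sumr.
apply: eq_bigr => i _; rewrite mulr_sumr; apply: eq_bigr => j _.
by rewrite !mxE; ring.
Qed.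

Lemma conn_formDl a y u u' v :
  conn_form a y (u + u') v = conn_form a y u v + conn_form a y u' v.
Proof.
apply/rowP => h; rewrite !mxE -big_split; apply: eq_bigr => i _.
by rewrite -big_split; apply: eq_bigr => j _; rewrite !mxE mulrDr mulrDl.
Qed.

Lemma conn_formDr a y u v v' :
  conn_form a y u (v + v') = conn_form a y u v + conn_form a y u v'.
Proof.
apply/rowP => h; rewrite !mxE -big_split; apply: eq_bigr => i _.
by rewrite -big_split; apply: eq_bigr => j _; rewrite !mxE mulrDr.
Qed.

(** This gives the values of the Christoffel symbols from the covariant
    derivatives of known fields. *)
Lemma nabla_vecE a (X Y : 'rV[R]_n -> 'rV[R]_n) y :
  (forall h, differentiable (fun z => Y z 0 h) y) ->
  nabla_vec D a X Y y =
    (\row_h 'D_(X y) (fun z => Y z 0 h) y) + conn_form a y (X y) (Y y).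
Proof.
move=> dY; apply/rowP => h; rewrite !mxE; congr (_ + _).
by rewrite derive_sum_partial.
Qed.

End ConnectionForm.

Lemma sum_scale_row_mx (R : realType) m n (I : finType) (c : I -> R)
    (A : I -> 'rV[R]_m) (B : I -> 'rV[R]_n) :
  \sum_i c i *: row_mx (A i) (B i) =
  row_mx (\sum_i c i *: A i) (\sum_i c i *: B i).
Proof.
elim: (index_enum I) => [|i s IH]; first by rewrite !big_nil row_mx0.
by rewrite !big_cons IH scale_row_mx add_row_mx.
Qed.

Section Bundle.
Variables (R : realType) (n p q : nat) (M : atlas R n) (D : connection M)
  (g : riemannian M) (f : M -> R).

Local Notation K := (tdim n p q).

(** The quadratic form of the tensor fA; rescaling_formE gives it without
    indices. *)
Definition rescaling_form (a : chart M) (y v : 'rV[R]_n) : 'rV[R]_n :=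
  \row_h \sum_l \sum_j v 0 l * v 0 j * fA g f a l j h y.

(** When D is the Levi-Civita connection of g, this is the quadratic form of the
    Levi-Civita connection of the metric f g. *)
Definition rescaled_form (a : chart M) (y v : 'rV[R]_n) : 'rV[R]_n :=
  conn_form D a y v v + (2 * in_chart a f y)^-1 *: rescaling_form a y v.

Variables (G : riemannian (tensor_bundle M p q))
  (Dh : connection (tensor_bundle M p q)).
Hypothesis oM : forall a : chart M, open (chart_img a).
Hypothesis hDh : metric_connection D g f G Dh.

Lemma hlift_cst a (v y : 'rV[R]_n) (t : 'rV[R]_K) :
  hlift D a (fun=> v) (row_mx y t) = row_mx v (- (t *m gam_dir p q D a v y)).
Proof. by rewrite /hlift row_mxKl row_mxKr gam_dirE. Qed.

Lemma hlift_coord a l (y : 'rV[R]_n) (t : 'rV[R]_K) :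
  hlift D a (coord_field l) (row_mx y t) =
  row_mx (delta_mx 0 l) (- (t *m gam_dir p q D a (delta_mx 0 l) y)).
Proof. exact: hlift_cst. Qed.

Lemma smooth_vec_on_cst m m' (U : set 'rV[R]_m) (v : 'rV[R]_m') :
  smooth_vec_on U (fun=> v).
Proof.
move=> k s y _.
have [c ->] : exists c, foldr (@partial R m) (fun=> v 0 k) s = fun=> c.
  elim: s => [|i s [c IH]]; first by exists (v 0 k).
  by exists 0 => /=; rewrite IH; apply/funext => z; exact: derive_cst.
by split=> [|i]; [exact: cst_continuous|exact: derivable_cst].
Qed.

Lemma differentiable_hlift a (v : 'rV[R]_n) (y : 'rV[R]_n) (t : 'rV[R]_K) h :
  chart_img a y ->
  differentiable (fun z : 'rV[R]_(n + K) => hlift D a (fun=> v) z 0 h) (row_mx y t).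
Proof.
move=> ay; rewrite -(splitK h) /unsplit; case: (fintype.split h) => k.
  under [fun w => _]funext => w do rewrite row_mxEl.
  exact: differentiable_cst.
under [fun w => _]funext => w do rewrite row_mxEr mxE gam_dirE.
by apply: differentiableN; apply: differentiable_gam_dir; rewrite ?row_mxKl.
Qed.

(** The correction by which covariant derivatives of horizontal lifts differ
    from values of the Christoffel symbols. *)
Lemma derive_hlift a (v v' : 'rV[R]_n) (y : 'rV[R]_n) (t u : 'rV[R]_K) :
  chart_img a y ->
  \row_h 'D_(row_mx v u) (fun z => hlift D a (fun=> v') z 0 h) (row_mx y t) =
  row_mx 0 (- (u *m gam_dir p q D a v' y + t *m dgam_dir p q D a v v' y)).
Proof.
move=> ay; apply/rowP => h; rewrite mxE.
rewrite -(splitK h) /unsplit; case: (fintype.split h) => k.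
  under [fun w => _]funext => w do rewrite row_mxEl.
  by rewrite row_mxEl mxE derive_cst.
under [fun w => _]funext => w do rewrite row_mxEr mxE gam_dirE.
rewrite row_mxEr mxE.
have dk := @is_derive_gam_dir R n M p q D a t u y v' v k (@oM a) ay.
have [_ <-] := dk.
by rewrite deriveN//; case: dk.
Qed.

Lemma bundle_chart_img (a : chart M) (w : 'rV[R]_(n + K)) :
  @chart_img R _ (tensor_bundle M p q) a w -> chart_img a (lsubmx w).
Proof. by move=> [u au <-]; rewrite row_mxKl; exists (projT1 u). Qed.

Section AtPoint.
Variables (a : chart M) (y : 'rV[R]_n) (t : 'rV[R]_K).
Hypothesis aw : @chart_img R _ (tensor_bundle M p q) a (row_mx y t).

Let ay : chart_img a y.
Proof. by have := bundle_chart_img aw; rewrite row_mxKl. Qed.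

Local Notation w := (row_mx y t).
Local Notation Gd v := (gam_dir p q D a v y).
Local Notation H v := (row_mx v (- (t *m Gd v)) : 'rV[R]_(n + K)).
Local Notation V u := (row_mx 0 u : 'rV[R]_(n + K)).

Lemma conn_form_VV (u u' : 'rV[R]_K) : conn_form Dh a w (V u) (V u') = 0.
Proof.
have [_ _ _ /(_ (fun=> u) (fun=> u'))] := hDh.2 a w aw.
move=> /(_ (@smooth_vec_on_cst _ _ _ _) (@smooth_vec_on_cst _ _ _ _)).
rewrite nabla_vecE/=; last by move=> h; exact: differentiable_cst.
move=> <-; rewrite [X in X + _](_ : _ = 0) ?add0r//.
by apply/rowP => h; rewrite [LHS]mxE [RHS]mxE; exact: derive_cst.
Qed.

(** The connection annihilates a horizontal lift in a vertical direction, but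
    the lift itself varies linearly in the fibre. *)
Lemma conn_form_VH (u : 'rV[R]_K) (v : 'rV[R]_n) :
  conn_form Dh a w (V u) (H v) = V (u *m Gd v).
Proof.
have [_ _ /(_ (fun=> u) (fun=> v)) E _] := hDh.2 a w aw.
move: E => /(_ (@smooth_vec_on_cst _ _ _ _) (@smooth_vec_on_cst _ _ _ _)).
rewrite nabla_vecE/=; last by move=> h; exact: differentiable_hlift.
rewrite hlift_cst derive_hlift// dgam_dir0 mulmx0 addr0 addrC => /eqP.
rewrite addr_eq0 => /eqP ->.
by rewrite opp_row_mx oppr0 opprK.
Qed.

Lemma conn_form_HV (u : 'rV[R]_K) (v : 'rV[R]_n) :
  conn_form Dh a w (H v) (V u) = V (u *m Gd v).
Proof.
have [_ /(_ (fun=> v) (fun=> u)) E _ _] := hDh.2 a w aw.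
move: E => /(_ (@smooth_vec_on_cst _ _ _ _) (@smooth_vec_on_cst _ _ _ _)).
rewrite nabla_vecE/=; last by move=> h; exact: differentiable_cst.
rewrite [X in X + _](_ : _ = 0) ?add0r; last first.
  by apply/rowP => h; rewrite [LHS]mxE [RHS]mxE; exact: derive_cst.
rewrite hlift_cst => ->; congr (row_mx 0 _).
rewrite /nabla_tensor row_mxKl -gam_dirE; apply: eq_bigr => s _; congr (_ *: _).
rewrite [X in X + _](_ : _ = 0) ?add0r//.
by apply/rowP => k; rewrite [LHS]mxE [RHS]mxE; exact: derive_cst.
Qed.

Lemma conn_form_HH_coord l j :
  conn_form Dh a w (H (delta_mx 0 l)) (H (delta_mx 0 j)) =
  let Glj := \row_r (gam D a r l j y + (2 * in_chart a f y)^-1 * fA g f a l j r y) in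
  row_mx Glj (t *m dgam_dir p q D a (delta_mx 0 l) (delta_mx 0 j) y
    - t *m Gd (delta_mx 0 l) *m Gd (delta_mx 0 j) - t *m Gd Glj).
Proof.
have [/(_ l j) E _ _ _] := hDh.2 a w aw.
move: E; rewrite nabla_vecE/=; last by move=> h; exact: differentiable_hlift.
rewrite !hlift_coord derive_hlift// => /(canRL (addKr _)) ->.
rewrite opp_row_mx oppr0 opprK /hlift row_mxKl row_mxKr gam_dirE add_row_mx add0r.
by rewrite mulNmx [_ + t *m dgam_dir _ _ _ _ _ _ _]addrC.
Qed.

Lemma rescaled_form_sum (v : 'rV[R]_n) :
  rescaled_form a y v = \sum_l v 0 l *: \sum_j v 0 j *:
    \row_r (gam D a r l j y + (2 * in_chart a f y)^-1 * fA g f a l j r y).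
Proof.
apply/rowP => r; rewrite !mxE summxE mulr_sumr -big_split/=.
apply: eq_bigr => l _; rewrite mxE summxE !mulr_sumr -big_split/=.
by apply: eq_bigr => j _; rewrite !mxE; ring.
Qed.

Lemma gam_dir_delta (v : 'rV[R]_n) : \sum_l v 0 l *: Gd (delta_mx 0 l) = Gd v.
Proof. by rewrite -gam_dir_sum -row_sum_delta. Qed.

Lemma dgam_dir_delta (v : 'rV[R]_n) :
  \sum_l v 0 l *: \sum_j v 0 j *: dgam_dir p q D a (delta_mx 0 l) (delta_mx 0 j) y
  = dgam_dir p q D a v v y.
Proof.
apply/matrixP => i k; rewrite dgam_dir_entry summxE.
under [RHS]eq_bigr => s _.
  rewrite derive_sum_partial; last exact: differentiable_gam_mx.
  rewrite mulr_sumr; over.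
rewrite exchange_big; apply: eq_bigr => l _; rewrite mxE summxE mulr_sumr.
apply: eq_bigr => j _; rewrite mxE dgam_dir_entry (bigD1 j)//= big1.
  by rewrite mxE !eqxx mul1r addr0 mulrCA.
by move=> s /negPf sj; rewrite mxE sj andbF mul0r.
Qed.

(** The connection is prescribed on the lifts of coordinate fields only, and the
    lift of a constant field is a linear combination of these. *)
Lemma conn_form_HH (v : 'rV[R]_n) :
  conn_form Dh a w (H v) (H v) =
  row_mx (rescaled_form a y v) (t *m dgam_dir p q D a v v y
    - t *m Gd v *m Gd v - t *m Gd (rescaled_form a y v)).
Proof.
have HE (x : 'rV[R]_n) : H x = \sum_l x 0 l *: H (delta_mx 0 l).
  rewrite sum_scale_row_mx -row_sum_delta -gam_dir_delta mulmx_sumr -sumrN.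
  congr row_mx; apply: eq_bigr => l _; by rewrite -scalemxAr scalerN.
rewrite [in LHS]HE conn_form_suml.
under eq_bigr => l _ do rewrite conn_form_sumr.
under eq_bigr => l _ do under eq_bigr => j _ do rewrite conn_form_HH_coord/=.
under eq_bigr => l _ do rewrite sum_scale_row_mx.
rewrite sum_scale_row_mx -rescaled_form_sum; congr row_mx.
have E2 : \sum_l v 0 l *: \sum_j v 0 j *:
    (t *m Gd (delta_mx 0 l) *m Gd (delta_mx 0 j)) = t *m Gd v *m Gd v.
  rewrite -[X in _ = t *m X *m _]gam_dir_delta [X in _ = X *m _]mulmx_sumr mulmx_suml.
  apply: eq_bigr => l _; rewrite -scalemxAr -scalemxAl; congr (_ *: _).
  by rewrite -(gam_dir_delta v) [RHS]mulmx_sumr; apply: eq_bigr => j _; rewrite -scalemxAr.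
have E3 : \sum_l v 0 l *: \sum_j v 0 j *:
    (t *m Gd (\row_r (gam D a r l j y + (2 * in_chart a f y)^-1 * fA g f a l j r y)))
    = t *m Gd (rescaled_form a y v).
  rewrite rescaled_form_sum gam_dir_sum [RHS]mulmx_sumr; apply: eq_bigr => l _.
  rewrite -scalemxAr gam_dir_sum [X in _ = _ *: X]mulmx_sumr; congr (_ *: _).
  apply: eq_bigr => j _.
  by rewrite -scalemxAr.
have E1 : \sum_l v 0 l *: \sum_j v 0 j *:
    (t *m dgam_dir p q D a (delta_mx 0 l) (delta_mx 0 j) y)
    = t *m dgam_dir p q D a v v y.
  rewrite -dgam_dir_delta [RHS]mulmx_sumr; apply: eq_bigr => l _.
  rewrite -scalemxAr [X in _ = _ *: X]mulmx_sumr; congr (_ *: _); apply: eq_bigr => j _.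
  by rewrite -scalemxAr.
apply: etrans (congr2 (fun A B => A - B) (congr2 (fun A B => A - B) E1 E2) E3).
rewrite -!sumrB; apply: eq_bigr => l _; rewrite -!scalerBr; congr (_ *: _).
by rewrite -!sumrB; apply: eq_bigr => j _; rewrite -!scalerBr.
Qed.

(** Bilinearity, for the decomposition of (v, u) into the horizontal lift of v and
    the vertical vector u + t Gamma(v). Both mixed terms contribute
    (u + t Gamma(v)) Gamma(v), whence the factor 2; the term t Gamma(v) Gamma(v)
    that the horizontal part subtracts cancels one of the two so obtained. *)
Lemma bundle_conn_form (v : 'rV[R]_n) (u : 'rV[R]_K) :
  conn_form Dh a w (row_mx v u) (row_mx v u) =
  row_mx (rescaled_form a y v)
    (u *m Gd v *+ 2 + t *m dgam_dir p q D a v v y + t *m Gd v *m Gd v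
      - t *m Gd (rescaled_form a y v)).
Proof.
have -> : row_mx v u = H v + V (u + t *m Gd v).
  by rewrite add_row_mx addr0 addrCA addNr addr0.
rewrite conn_formDl !conn_formDr conn_form_HH conn_form_HV conn_form_VH conn_form_VV.
rewrite addr0 !add_row_mx !addr0 mulmxDl; congr row_mx.
rewrite mulr2n !addrA.
set x1 := u *m _; set x2 := t *m _ *m _; set x3 := t *m dgam_dir _ _ _ _ _ _ _.
set x4 := t *m _; apply/rowP => k; rewrite !mxE; ring.
Qed.

End AtPoint.
End Bundle.

(** * The second covariant derivative along a curve *)

Definition velocity (R : realType) n (x : R -> 'rV[R]_n) (t : R) : 'rV[R]_n :=
  \row_k derive1 (fun s => x s 0 k) t.

Definition acceleration (R : realType) n (x : R -> 'rV[R]_n) (t : R) : 'rV[R]_n :=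
  \row_k derive1n 2 (fun s => x s 0 k) t.

Section SecondCovariantDerivative.
Variables (R : realType) (n p q : nat) (M : atlas R n) (D : connection M).
Local Notation K := (tdim n p q).
Variables (a : chart M) (x : R -> 'rV[R]_n) (T : R -> 'rV[R]_K) (t : R).
Hypothesis oa : open (chart_img a).
Hypothesis ax : chart_img a (x t).
Hypothesis dx : forall k l, derivable (derive1n l (fun s => x s 0 k)) t 1.
Hypothesis dT : forall k l, derivable (derive1n l (fun s => T s 0 k)) t 1.

Local Notation Gd := (gam_dir p q D a).

Lemma nabla_alongE s :
  nabla_along D a x T s = velocity T s + T s *m Gd (velocity x s) (x s).
Proof.
rewrite -gam_dirE; congr (_ + _); apply: eq_bigr => i _; by rewrite mxE.
Qed.

Lemma is_derive_gam_mx s i j :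
  is_derive t 1 (fun r => gam_mx p q D a s (x r) i j)
    ('D_(velocity x t) (fun z => gam_mx p q D a s z i j) (x t)).
Proof.
have dg : differentiable (fun z => gam_mx p q D a s z i j) (x t).
  exact: differentiable_gam_mx.
have := is_derive_chain dg (fun k => @dx k 0%N); move/is_derive_eq; apply.
by rewrite derive_sum_partial//; apply: eq_bigr => k _; rewrite mxE.
Qed.

(** The product rule. The derivative of the matrix Gamma(x') along the curve has
    one term from x'' and one from the dependence of Gamma on the point. *)
Lemma nabla_along_twice :
  nabla_along D a x (nabla_along D a x T) t =
  acceleration T t + T t *m Gd (acceleration x t) (x t)
  + velocity T t *m Gd (velocity x t) (x t) *+ 2
  + T t *m dgam_dir p q D a (velocity x t) (velocity x t) (x t)
  + T t *m Gd (velocity x t) (x t) *m Gd (velocity x t) (x t).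
Proof.
rewrite {1}/nabla_along.
under [X in _ + X]eq_bigr => s _.
  rewrite (_ : derive1 _ t = velocity x t 0 s); last by rewrite mxE.
  over.
rewrite gam_dirE nabla_alongE mulmxDl.
suff -> : \row_k derive1 (fun r => nabla_along D a x T r 0 k) t =
    acceleration T t + velocity T t *m Gd (velocity x t) (x t)
    + T t *m Gd (acceleration x t) (x t)
    + T t *m dgam_dir p q D a (velocity x t) (velocity x t) (x t).
  set x1 := velocity T t *m _; set x2 := T t *m _; set x3 := T t *m dgam_dir _ _ _ _ _ _ _.
  set x4 := T t *m _ *m _; clearbody x1 x2 x3 x4.
  by apply/rowP => k; rewrite !mxE; ring.
apply/rowP => k; rewrite mxE.
have E : (fun r => nabla_along D a x T r 0 k) = (fun r => derive1 (fun s => T s 0 k) r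
   + \sum_j T r 0 j * \sum_s derive1 (fun r => x r 0 s) r * gam_mx p q D a s (x r) j k).
  apply/funext => r; rewrite nabla_alongE mxE mxE mxE; congr (_ + _).
  apply: eq_bigr => j _; congr (_ * _); rewrite gam_dir_entry.
  by apply: eq_bigr => s _; rewrite mxE.
have dxs s : is_derive t 1 (derive1 (fun r => x r 0 s)) (acceleration x t 0 s).
  by rewrite mxE; split; [exact: (@dx s 1%N)|rewrite -derive1E].
have dTj j : is_derive t 1 (fun r => T r 0 j) (velocity T t 0 j).
  by rewrite mxE; split; [exact: (@dT j 0%N)|rewrite -derive1E].
have dT1 : is_derive t 1 (derive1 (fun r => T r 0 k)) (acceleration T t 0 k).
  by rewrite mxE; split; [exact: (@dT k 1%N)|rewrite -derive1E].
have dsum := is_deriveD dT1 (is_derive_bigsum (fun j => is_deriveM (dTj j)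
  (is_derive_bigsum (fun s => is_deriveM (dxs s) (is_derive_gam_mx s j k))))).
rewrite E derive1E; case: dsum => _ /=; move=> ->.
rewrite !mxE -!addrA; congr (_ + _); rewrite -!big_split/=; apply: eq_bigr => j _.
rewrite /GRing.scale/= !gam_dir_entry dgam_dir_entry.
rewrite [RHS]addrC -mulrDr -big_split/=; congr (_ + _).
  congr (_ * _); apply: eq_bigr => s _. rewrite [LHS]addrC.
  by congr (_ + _); [exact: mulrC|rewrite mxE].
by rewrite [LHS]mulrC; congr (_ * _); apply: eq_bigr => s _; rewrite mxE.
Qed.

End SecondCovariantDerivative.

(** * The geodesic equation of the bundle *)

Lemma geodesic_equationP (R : realType) n (M : atlas R n) (D : connection M)
    (a : chart M) (x : R -> 'rV[R]_n) (t : R) :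
  (forall h, derive1n 2 (fun s => x s 0 h) t + \sum_i \sum_j gam D a h i j (x t) *
      derive1 (fun s => x s 0 i) t * derive1 (fun s => x s 0 j) t = 0) <->
  acceleration x t + conn_form D a (x t) (velocity x t) (velocity x t) = 0.
Proof.
have E h : (acceleration x t + conn_form D a (x t) (velocity x t) (velocity x t)) 0 h =
    derive1n 2 (fun s => x s 0 h) t + \sum_i \sum_j gam D a h i j (x t) *
      derive1 (fun s => x s 0 i) t * derive1 (fun s => x s 0 j) t.
  rewrite !mxE; congr (_ + _); apply: eq_bigr => i _; apply: eq_bigr => j _.
  by rewrite !mxE.
split=> [H|H h]; first by apply/rowP => h; rewrite E H mxE.
by rewrite -E H mxE.
Qed.

Lemma gam_dirN (R : realType) n p q (M : atlas R n) (D : connection M) a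
    (v y : 'rV[R]_n) : gam_dir p q D a (- v) y = - gam_dir p q D a v y.
Proof.
by rewrite /gam_dir -sumrN; apply: eq_bigr => s _; rewrite mxE scaleNr.
Qed.

Lemma velocity_row_mx (R : realType) m n (x : R -> 'rV[R]_m) (y : R -> 'rV[R]_n) t :
  velocity (fun s => row_mx (x s) (y s)) t = row_mx (velocity x t) (velocity y t).
Proof.
apply/rowP => h; rewrite mxE -(splitK h) /unsplit; case: (fintype.split h) => k.
  by rewrite row_mxEl mxE; under [fun s => _]funext => s do rewrite row_mxEl.
by rewrite row_mxEr mxE; under [fun s => _]funext => s do rewrite row_mxEr.
Qed.

Lemma acceleration_row_mx (R : realType) m n (x : R -> 'rV[R]_m)
    (y : R -> 'rV[R]_n) t :
  acceleration (fun s => row_mx (x s) (y s)) t =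
  row_mx (acceleration x t) (acceleration y t).
Proof.
apply/rowP => h; rewrite mxE -(splitK h) /unsplit; case: (fintype.split h) => k.
  by rewrite row_mxEl mxE; under [fun s => _]funext => s do rewrite row_mxEl.
by rewrite row_mxEr mxE; under [fun s => _]funext => s do rewrite row_mxEr.
Qed.

Section BundleGeodesics.
Variables (R : realType) (n p q : nat) (M : atlas R n) (D : connection M)
  (g : riemannian M) (f : M -> R) (G : riemannian (tensor_bundle M p q))
  (Dh : connection (tensor_bundle M p q)).
Local Notation K := (tdim n p q).
Hypothesis oM : forall a : chart M, open (chart_img a).
Hypothesis hDh : metric_connection D g f G Dh.

(** The first components of the two sides agree by bundle_conn_form. By the first
    equation, the term - t Gamma(rescaled_form) of the fibre component is
    t Gamma(x''), and then the fibre component is the second covariant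
    derivative computed in nabla_along_twice. *)
Lemma bundle_geodesic_equationP (a : chart M) (x : R -> 'rV[R]_n)
    (T : R -> 'rV[R]_K) (t : R) :
  @chart_img R _ (tensor_bundle M p q) a (row_mx (x t) (T t)) ->
  (forall k l, derivable (derive1n l (fun s => x s 0 k)) t 1) ->
  (forall k l, derivable (derive1n l (fun s => T s 0 k)) t 1) ->
  let w s := row_mx (x s) (T s) in
  acceleration w t + conn_form Dh a (w t) (velocity w t) (velocity w t) = 0 <->
  acceleration x t + rescaled_form D g f a (x t) (velocity x t) = 0 /\
  nabla_along D a x (nabla_along D a x T) t = 0.
Proof.
move=> aw dx dT w; have ax : chart_img a (x t).
  by have := bundle_chart_img aw; rewrite row_mxKl.
rewrite acceleration_row_mx velocity_row_mx (bundle_conn_form oM hDh aw) add_row_mx.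
rewrite (nabla_along_twice D (@oM a) ax dx dT).
have row0 (A : 'rV[R]_n) (B : 'rV[R]_K) : row_mx A B = 0 <-> A = 0 /\ B = 0.
  split=> [/eqP|[-> ->]]; last by rewrite row_mx0.
  by rewrite row_mx_eq0 => /andP[/eqP -> /eqP ->].
rewrite row0.
have E : acceleration x t + rescaled_form D g f a (x t) (velocity x t) = 0 ->
  rescaled_form D g f a (x t) (velocity x t) = - acceleration x t.
  by move/eqP; rewrite addrC addr_eq0 => /eqP.
have F : acceleration x t + rescaled_form D g f a (x t) (velocity x t) = 0 ->
  acceleration T t +
  (velocity T t *m gam_dir p q D a (velocity x t) (x t) *+ 2 +
   T t *m dgam_dir p q D a (velocity x t) (velocity x t) (x t) +
   T t *m gam_dir p q D a (velocity x t) (x t) *m gam_dir p q D a (velocity x t) (x t) -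
   T t *m gam_dir p q D a (rescaled_form D g f a (x t) (velocity x t)) (x t)) =
  acceleration T t + T t *m gam_dir p q D a (acceleration x t) (x t)
  + velocity T t *m gam_dir p q D a (velocity x t) (x t) *+ 2
  + T t *m dgam_dir p q D a (velocity x t) (velocity x t) (x t)
  + T t *m gam_dir p q D a (velocity x t) (x t) *m gam_dir p q D a (velocity x t) (x t).
  move=> /E ->; rewrite gam_dirN mulmxN opprK.
  set x1 := velocity T t *m _; set x2 := T t *m gam_dir _ _ _ _ (acceleration x t) _.
  set x3 := T t *m dgam_dir _ _ _ _ _ _ _.
  set x4 := T t *m _ *m _; clearbody x1 x2 x3 x4.
  by apply/rowP => k; rewrite !mxE; ring.
by split=> -[A B]; split=> //; [rewrite -F|rewrite F].
Qed.

End BundleGeodesics.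

(** * Changes of charts *)

Section ChartChange.
Variables (R : realType) (n : nat) (M : atlas R n).
Hypothesis hM : smooth_manifold M.

Definition overlap (a b : chart M) : set 'rV[R]_n :=
  chart_map a @` (chart_dom a `&` chart_dom b).

Lemma chart_map_inj (a : chart M) x y : chart_dom a x -> chart_dom a y ->
  chart_map a x = chart_map a y -> x = y.
Proof. by case: hM => _ + _ _ _; apply. Qed.

Lemma in_chartE (a : chart M) (V : zmodType) (F : M -> V) x :
  chart_dom a x -> in_chart a F (chart_map a x) = F x.
Proof.
move=> ax; rewrite /in_chart; set S := [set F x | x in _].
have : S (xget 0 S) by apply: (@xgetPex _ 0 S); exists (F x); exists x.
by case=> z [az zx] <-; rewrite (chart_map_inj az ax zx).
Qed.

Lemma open_overlap (a b : chart M) : open (overlap a b).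
Proof. by case: hM => _ _ /(_ a b)[]. Qed.

Lemma smooth_trans (a b : chart M) k : smooth_on (overlap a b) (fun y => trans a b y 0 k).
Proof. by case: hM => _ _ /(_ a b)[_ /(_ k)]. Qed.

Lemma open_chart_img (a : chart M) : open (chart_img a).
Proof.
have := @open_overlap a a; rewrite /overlap setIid; exact.
Qed.

Lemma gram_unitmx (g : riemannian M) (a : chart M) y : chart_img a y -> gram g a y \in unitmx.
Proof.
move=> ay; rewrite -row_free_unit -kermx_eq0; apply/negPn/negP => /rowV0Pn[v].
move=> /sub_kermxP vg v0; have := gram_pos g ay v0.
by rewrite vg mul0mx mxE ltxx.
Qed.

(** The transformation law of a metric exhibits the Jacobian matrix as a factor
    of an invertible matrix. *)
Lemma jac_unitmx (g : riemannian M) (a b : chart M) x : chart_dom a x -> chart_dom b x ->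
  jac a b x \in unitmx.
Proof.
move=> ax bx; have := @gram_unitmx g a (chart_map a x) (ex_intro2 _ _ x ax erefl).
by rewrite (gram_law g ax bx) !unitmx_mul => /andP[/andP[]].
Qed.

Definition differential_row (f : M -> R) (a : chart M) (y : 'rV[R]_n) : 'rV[R]_n :=
  \row_k partial k (in_chart a f) y.

(** The chain rule, along the image under the transition map of a coordinate
    line. *)
Lemma differential_row_change f (a b : chart M) (x : M) : smooth_function f ->
  chart_dom a x -> chart_dom b x ->
  differential_row f a (chart_map a x) =
  differential_row f b (chart_map b x) *m (jac a b x)^T.
Proof.
move=> sf ax bx; set y0 := chart_map a x.
have Oy0 : overlap a b y0 by exists x.
apply/rowP => i; rewrite !mxE.
pose c (s : R) := trans a b (s *: delta_mx 0 i + y0).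
have dtr k : is_derive (0 : R) 1 (fun s => c s 0 k) (jac a b x i k).
  apply: (is_derive_line (fun y => trans a b y 0 k) y0 _ 0 _).1.
  rewrite scale0r add0r mxE; apply: derivableP; apply: diff_derivable.
  exact: smooth_on_differentiable (@open_overlap a b) (@smooth_trans a b k) Oy0.
have c0 : c 0 = chart_map b x by rewrite /c scale0r add0r /trans in_chartE.
have db : differentiable (in_chart b f) (c 0).
  rewrite c0; apply: (smooth_on_differentiable (@open_chart_img b) (sf b)).
  by exists x.
have dk k : derivable (fun s => c s 0 k) 0 1 by case: (dtr k).
have dch := is_derive_chain db dk.
have near_ab : \forall y \near y0, in_chart b f (trans a b y) = in_chart a f y.
  have := open_nbhs_nbhs (conj (@open_overlap a b) Oy0); apply: filterS => y.
  by move=> [z [az bz] <-]; rewrite /trans !in_chartE.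
have : 'D_(delta_mx 0 i) (in_chart b f \o trans a b) y0 =
    \sum_k derive1 (fun s => c s 0 k) 0 * partial k (in_chart b f) (c 0).
  have /(is_derive_line (in_chart b f \o trans a b) y0 _ 0 _).2 := dch.
  by rewrite scale0r add0r => -[_ <-].
rewrite /partial (near_eq_derive _ near_ab) => ->; apply: eq_bigr => k _.
rewrite !mxE c0 mulrC derive1E; congr (_ * _).
by have [_ ->] := dtr k; rewrite mxE.
Qed.

Section Curve.
Variables (J : set R) (c : R -> M) (a : chart M).
Hypothesis oJ : open J.
Hypothesis ac : forall s, J s -> chart_dom a (c s).
Let x s := chart_map a (c s).
Hypothesis dx : forall s, J s -> forall k l, derivable (derive1n l (fun s => x s 0 k)) s 1.

Variable b : chart M.
Let J' := J `&` [set s | chart_dom b (c s)].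
Let xb s := chart_map b (c s).

Let Ox s : J' s -> overlap a b (x s).
Proof. by move=> [Js bs]; exists (c s) => //; split=> //; exact: ac. Qed.

(** In the chart a, the domain of the chart b is the open set overlap a b, and
    the curve is continuous. *)
Lemma open_chart_preimage : open J'.
Proof.
rewrite openE => s J's; have [Js bs] := J's.
have cx : {for s, continuous x}.
  apply: differentiable_continuous; apply/derivable1_diffP.
  by apply: derivable_rowv => k; exact: (@dx s Js k 0%N).
have nO : \forall r \near s, overlap a b (x r).
  apply: cx; exact: open_nbhs_nbhs (conj (@open_overlap a b) (Ox J's)).
have nJ : \forall r \near s, J r by exact: open_nbhs_nbhs (conj oJ Js).
apply: filterS2 nO nJ => r [z [az bz] zr] Jr; split=> //=.
by rewrite -(chart_map_inj az (ac Jr) zr).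
Qed.

Let xbE s : J' s -> xb s = trans a b (x s).
Proof. by move=> [Js bs]; rewrite /trans in_chartE //; exact: ac. Qed.

Lemma chart_change_smooth s : J' s ->
  forall k l, derivable (derive1n l (fun s => xb s 0 k)) s 1.
Proof.
move=> J's k l; apply: (Ck_onP J' _).1 J's l => l.
apply: (@Ck_on_eq _ _ open_chart_preimage _ (fun s => trans a b (x s) 0 k)).
  by move=> r J'r; rewrite xbE.
apply: (Ck_on_comp open_chart_preimage (@open_overlap a b) Ox (@smooth_trans a b k)).
move=> j; move: l; apply/Ck_onP => r [Jr _] l; exact: dx.
Qed.

Lemma velocity_chart_change s : J' s ->
  velocity xb s = velocity x s *m jac a b (c s).
Proof.
move=> J's; apply/rowP => k; rewrite !mxE.
rewrite (@derive1_eq_on _ _ open_chart_preimage _ (fun s => trans a b (x s) 0 k))//;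
  last by move=> r J'r; rewrite xbE.
have dt := smooth_on_differentiable (@open_overlap a b) (@smooth_trans a b k) (Ox J's).
have := is_derive_chain dt (fun k => @dx s J's.1 k 0%N).
rewrite derive1E => -[_ ->]; apply: eq_bigr => i _.
by rewrite !mxE.
Qed.

Lemma acceleration_chart_change s : J' s ->
  acceleration xb s = acceleration x s *m jac a b (c s) +
    \row_k \sum_i \sum_j velocity x s 0 i * velocity x s 0 j *
      partial i (partial j (fun y => trans a b y 0 k)) (x s).
Proof.
move=> J's; apply/rowP => k; rewrite [LHS]mxE /derive1n/=.
rewrite (@derive1_eq_on _ _ open_chart_preimage _ (fun r => \sum_j
    derive1 (fun s => x s 0 j) r * partial j (fun y => trans a b y 0 k) (x r)))//;
  last first.
  move=> r J'r; have := velocity_chart_change J'r => /rowP/(_ k).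
  by rewrite !mxE => ->; apply: eq_bigr => i _; rewrite !mxE.
have d2 j := smooth_on_differentiable (@open_overlap a b)
  (smooth_on_partial j (@smooth_trans a b k)) (Ox J's).
have dp j := is_derive_chain (d2 j) (fun k => @dx s J's.1 k 0%N).
have dv j : is_derive s 1 (derive1 (fun r => x r 0 j)) (acceleration x s 0 j).
  by rewrite mxE; split; [exact: (@dx s J's.1 j 1%N)|rewrite -derive1E].
have := is_derive_bigsum (fun j => is_deriveM (dv j) (dp j)).
rewrite derive1E => -[_ ->]; rewrite !mxE.
rewrite [X in _ = _ + X]exchange_big -big_split; apply: eq_bigr => j _ /=.
rewrite [LHS]addrC /GRing.scale/=; congr (_ + _).
  by rewrite [LHS]mulrC; congr (_ * _); rewrite [RHS]mxE.
rewrite mulr_sumr; apply: eq_bigr => i _; rewrite !mxE; ring.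
Qed.

(** x'' + Gamma(x', x') is a vector: the second derivatives of the transition map
    that come from differentiating x' twice cancel those of the transformation
    law of the Christoffel symbols. *)
Lemma conn_form_chart_change (D : connection M) s : J' s ->
  acceleration xb s + conn_form D b (xb s) (velocity xb s) (velocity xb s) =
  (acceleration x s + conn_form D a (x s) (velocity x s) (velocity x s))
    *m jac a b (c s).
Proof.
move=> J's; have [Js bs] := J's.
rewrite acceleration_chart_change// velocity_chart_change// mulmxDl -addrA.
congr (_ + _); set v := velocity x s; apply/rowP => k; rewrite mxE !mxE.
have -> : \sum_j conn_form D a (x s) v v 0 j * jac a b (c s) j k =
    \sum_i \sum_j v 0 i * v 0 j *
      (\sum_h gam D a h i j (x s) * jac a b (c s) h k).
  under eq_bigr => h _.
    rewrite [X in X * _]mxE mulr_suml.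
    under eq_bigr => i _ do rewrite mulr_suml.
    over.
  rewrite exchange_big; apply: eq_bigr => i _ /=; rewrite exchange_big.
  apply: eq_bigr => j _ /=; rewrite mulr_sumr; apply: eq_bigr => h _; ring.
under [RHS]eq_bigr => i _ do under eq_bigr => j _ do
  rewrite (gam_law D (ac Js) bs) mulrDr.
under [RHS]eq_bigr => i _ do rewrite big_split.
rewrite big_split/=; congr (_ + _).
under eq_bigr => u _ do under eq_bigr => w _ do
  rewrite [X in _ * X * _]mxE [X in _ * _ * X]mxE mulr_sumr.
under eq_bigr => u _ do under eq_bigr => w _ do under eq_bigr => j _ do
  rewrite mulr_sumr mulr_suml.
under [RHS]eq_bigr => i _ do under eq_bigr => j _ do rewrite mulr_sumr.
under [RHS]eq_bigr => i _ do under eq_bigr => j _ do under eq_bigr => u _ do rewrite mulr_sumr.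
rewrite [RHS]exchange_big/=.
under [LHS]eq_bigr => u _ do rewrite exchange_big.
rewrite exchange_big /=; apply: eq_bigr => j _.
under [LHS]eq_bigr => u _ do rewrite exchange_big.
rewrite exchange_big /=; apply: eq_bigr => i _.
by apply: eq_bigr => u _; apply: eq_bigr => w _; rewrite !mxE; ring.
Qed.

End Curve.
End ChartChange.

(** * The rescaling term *)

Section RescalingForm.
Variables (R : realType) (n : nat) (M : atlas R n) (g : riemannian M) (f : M -> R).
Hypothesis hM : smooth_manifold M.
Hypothesis sf : smooth_function f.

(** The two terms of fA with Kronecker symbols both give df(v) v, and the third
    one gives |v|^2 grad f. *)
Lemma rescaling_formE (a : chart M) y v :
  rescaling_form g f a y v =
  (2 * (v *m (differential_row f a y)^T) 0 0) *: v -
  (v *m gram g a y *m v^T) 0 0 *: (differential_row f a y *m (invmx (gram g a y))^T).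
Proof.
set w := differential_row f a y.
have wE k : partial k (in_chart a f) y = w 0 k by rewrite mxE.
apply/rowP => h.
have S0 : (v *m w^T) 0 0 = \sum_l v 0 l * w 0 l.
  by rewrite mxE; apply: eq_bigr => l _; rewrite mxE.
have Sg : (v *m gram g a y *m v^T) 0 0 = \sum_l \sum_j v 0 l * v 0 j * gram g a y l j.
  rewrite mxE exchange_big; apply: eq_bigr => j _.
  rewrite [X in X * _]mxE mulr_suml; apply: eq_bigr => l _.
  by rewrite [X in _ * X = _]mxE; ring.
have Si : (w *m (invmx (gram g a y))^T) 0 h = \sum_m invmx (gram g a y) h m * w 0 m.
  by rewrite mxE; apply: eq_bigr => m _; rewrite [X in _ * X]mxE mulrC.
have -> : ((2 * (v *m w^T) 0 0) *: v - (v *m gram g a y *m v^T) 0 0 *: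
    (w *m (invmx (gram g a y))^T)) 0 h = 2 * (v *m w^T) 0 0 * v 0 h -
    (v *m gram g a y *m v^T) 0 0 * (w *m (invmx (gram g a y))^T) 0 h.
  by rewrite [LHS]mxE [X in X + _]mxE [X in _ + X]mxE [X in - X]mxE.
rewrite S0 Sg Si mxE; set c := \sum_m invmx (gram g a y) h m * w 0 m.
have -> : \sum_l \sum_j v 0 l * v 0 j * fA g f a l j h y =
    \sum_l \sum_j (v 0 l * v 0 j * (w 0 l * (j == h)%:R) +
      v 0 l * v 0 j * (w 0 j * (l == h)%:R) - c * (v 0 l * v 0 j * gram g a y l j)).
  apply: eq_bigr => l _; apply: eq_bigr => j _; rewrite /fA !wE.
  have -> : \sum_m invmx (gram g a y) h m * partial m (in_chart a f) y = c.
    by apply: eq_bigr => m _; rewrite wE.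
  by rewrite mulrBr mulrDr (mulrCA _ c).
have S1 : \sum_l \sum_j v 0 l * v 0 j * (w 0 l * (j == h)%:R) =
    (\sum_l v 0 l * w 0 l) * v 0 h.
  rewrite mulr_suml; apply: eq_bigr => l _; rewrite (bigD1 h)//= eqxx big1.
    by rewrite mulr1 addr0 mulrAC.
  by move=> j /negPf jh; rewrite jh !mulr0.
have S2 : \sum_l \sum_j v 0 l * v 0 j * (w 0 j * (l == h)%:R) =
    (\sum_l v 0 l * w 0 l) * v 0 h.
  by rewrite exchange_big -S1; apply: eq_bigr => l _; apply: eq_bigr => j _; ring.
under eq_bigr => l _ do rewrite sumrB big_split -mulr_sumr/=.
by rewrite sumrB big_split/= -mulr_sumr S1 S2; ring.
Qed.

(** The differential, the metric and its inverse are tensors, so df(v), |v|^2 and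
    grad f have an invariant meaning. *)
Lemma rescaling_form_change (a b : chart M) (x : M) v :
  chart_dom a x -> chart_dom b x ->
  rescaling_form g f b (chart_map b x) (v *m jac a b x) =
  rescaling_form g f a (chart_map a x) v *m jac a b x.
Proof.
move=> ax bx; rewrite !rescaling_formE (differential_row_change hM sf ax bx).
rewrite (gram_law g ax bx); set w := differential_row f b _.
set gb := gram g b _; set P := jac a b x.
have Pu : P \in unitmx := jac_unitmx g ax bx.
have gu : gb \in unitmx by apply: gram_unitmx; exists x.
rewrite mulmxBl -!scalemxAl !trmx_mul trmxK !mulmxA; congr (_ - _ *: _).
have -> : invmx (P *m gb *m P^T) = invmx P^T *m invmx gb *m invmx P.
  have Pt : P^T \in unitmx by rewrite unitmx_tr.
  have U : P *m gb *m P^T \in unitmx by rewrite !unitmx_mul Pu gu.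
  apply: (can_inj (mulKmx U)); rewrite mulmxV//.
  by rewrite !mulmxA mulmxK// mulmxK// mulmxV.
rewrite !trmx_mul !trmx_inv !trmxK !mulmxA mulmxK ?unitmx_tr//.
by rewrite mulmxKV.
Qed.

(** For v = grad f one has df(v) = |v|^2, so the form takes the value |v|^2 v,
    which vanishes only if v does. *)
Lemma rescaling_form_gradient (a : chart M) y :
  chart_img a y ->
  let v := differential_row f a y *m invmx (gram g a y) in
  rescaling_form g f a y v = 0 -> differential_row f a y = 0.
Proof.
move=> ay v; set w := differential_row f a y.
have gu : gram g a y \in unitmx by apply: gram_unitmx.
have wE : w = v *m gram g a y by rewrite /v mulmxKV.
rewrite rescaling_formE -/w trmx_inv gram_sym// -/v.
have -> : v *m w^T = v *m gram g a y *m v^T.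
  by rewrite wE trmx_mul gram_sym// mulmxA.
rewrite -scalerBl => /eqP; rewrite scaler_eq0 => /orP[/eqP|/eqP v0].
  move=> H; have [v0|v0] := eqVneq v 0; first by rewrite wE v0 mul0mx.
  have := gram_pos g ay v0; move: H; rewrite mulr_natl mulr2n addrK => ->.
  by rewrite ltxx.
by rewrite wE v0 mul0mx.
Qed.

Lemma rescaled_form_change (D : connection M) (J : set R) (c : R -> M) (a b : chart M)
    (s : R) :
  open J -> (forall s, J s -> chart_dom a (c s)) ->
  (forall s, J s -> forall k l,
     derivable (derive1n l (fun s => chart_map a (c s) 0 k)) s 1) ->
  J s -> chart_dom b (c s) ->
  let x s := chart_map a (c s) in let xb s := chart_map b (c s) in
  acceleration xb s + rescaled_form D g f b (xb s) (velocity xb s) =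
  (acceleration x s + rescaled_form D g f a (x s) (velocity x s)) *m jac a b (c s).
Proof.
move=> oJ ac dx Js bs x xb.
have := conn_form_chart_change hM oJ ac dx D (conj Js bs).
have := velocity_chart_change hM oJ ac dx (conj Js bs).
rewrite -/x -/xb => ve ce.
have comb (A C Q A' C' Q' : 'rV[R]_n) (k : R) (P : 'M[R]_n) :
    A' + C' = (A + C) *m P -> Q' = Q *m P ->
    A' + (C' + k *: Q') = (A + (C + k *: Q)) *m P.
  by move=> E ->; rewrite !addrA E [RHS]mulmxDl scalemxAl.
have fE : in_chart b f (xb s) = in_chart a f (x s).
  by rewrite /x /xb !(in_chartE hM)//; exact: ac.
rewrite /rescaled_form fE; apply: comb => //.
by rewrite ve; apply: rescaling_form_change => //; exact: ac.
Qed.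

End RescalingForm.

(** * The zero section *)

Section ZeroSection.
Variables (R : realType) (n p q : nat) (M : atlas R n).
Local Notation K := (tdim n p q).

Lemma tcoef0 (i : {ffun 'I_p -> 'I_n}) (j : {ffun 'I_q -> 'I_n}) :
  tcoef (0 : 'rV[R]_K) i j = 0.
Proof. by rewrite /tcoef mxE. Qed.

Fact zero_tensor_law (x : M) (a b : chart M) :
  chart_dom a x -> chart_dom b x ->
  forall (i' : {ffun 'I_p -> 'I_n}) (j' : {ffun 'I_q -> 'I_n}),
    tcoef (0 : 'rV[R]_K) i' j' =
    \sum_(i : {ffun 'I_p -> 'I_n}) \sum_(j : {ffun 'I_q -> 'I_n})
      (\prod_l jac a b x (i l) (i' l)) * (\prod_m jac b a x (j' m) (j m)) *
      tcoef (0 : 'rV[R]_K) i j.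
Proof.
move=> _ _ i' j'; rewrite tcoef0 big1// => i _; rewrite big1// => j _.
by rewrite tcoef0 mulr0.
Qed.

Definition zero_tensor (x : M) : tensor_at p q x :=
  @TensorAt R n M p q x (fun=> 0) (fun _ _ => erefl) (@zero_tensor_law x).

Definition zero_section (x : M) : tensor_bundle M p q := existT _ x (zero_tensor x).

Lemma chart_img_zero_section (a : chart M) y : chart_img a y ->
  @chart_img R _ (tensor_bundle M p q) a (row_mx y 0).
Proof. by move=> [x ax <-]; exists (zero_section x). Qed.

(** Moving y in the direction i moves (y, 0) in the direction i of the base, so
    even the difference quotients agree. *)
Lemma partial_zero_section (k : 'rV[R]_(n + K) -> R) i :
  partial i (fun y => k (row_mx y 0)) =
  (fun y => partial (lshift K i) k (row_mx y 0)) /\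
  (forall y, derivable k (row_mx y 0) (delta_mx 0 (lshift K i)) ->
    derivable (fun y => k (row_mx y 0)) y (delta_mx 0 i)).
Proof.
have E y : (fun e : R => e^-1 *: (((fun y => k (row_mx y 0)) \o shift y)
      (e *: delta_mx 0 i) - k (row_mx y 0))) =
    (fun e : R => e^-1 *: ((k \o shift (row_mx y 0))
      (e *: delta_mx 0 (lshift K i)) - k (row_mx y 0))).
  apply/funext => e /=; congr (_ *: (k _ - _)).
  apply/rowP => h; rewrite -(splitK h) /unsplit; case: (fintype.split h) => j.
    by rewrite row_mxEl [RHS]mxE row_mxEl !mxE (inj_eq (@lshift_inj _ _)).
  by rewrite row_mxEr [RHS]mxE row_mxEr !mxE eq_rlshift andbF mulr0 addr0.
split=> [|y]; last by rewrite /derivable E.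
by apply/funext => y; rewrite /partial /derive E.
Qed.

Lemma smooth_on_zero_section (U : set 'rV[R]_n) (V : set 'rV[R]_(n + K))
    (h : 'rV[R]_(n + K) -> R) :
  (forall y, U y -> V (row_mx y 0)) -> smooth_on V h ->
  smooth_on U (fun y => h (row_mx y 0)).
Proof.
move=> UV sh s y Uy.
have -> : foldr (@partial R n) (fun y => h (row_mx y 0)) s =
    fun y => foldr (@partial R (n + K)) h (map (lshift K) s) (row_mx y 0).
  by elim: s => //= i s ->; have [->] := partial_zero_section
    (foldr (@partial R (n + K)) h (map (lshift K) s)) i.
have [ch dh] := sh (map (lshift K) s) _ (UV y Uy).
split=> [|i]; last by apply: (partial_zero_section _ i).2; exact: dh.
apply: (@continuous_comp _ _ _ (fun y : 'rV[R]_n => row_mx y (0 : 'rV[R]_K))) => //.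
move=> B /nbhs_ballP[e/= e0 eB]; apply/nbhs_ballP; exists e => //= z.
move=> /(rowv_ballP _ _ e0) yz; apply: eB; apply/(rowv_ballP _ _ e0) => k.
rewrite -(splitK k) /unsplit; case: (fintype.split k) => j.
  by rewrite !row_mxEl.
by rewrite !row_mxEr mxE subrr normr0.
Qed.

End ZeroSection.

(** * Projections of geodesics *)

Lemma velocity_eq_on (R : realType) n (J : set R) (x x' : R -> 'rV[R]_n) t :
  open J -> (forall s, J s -> x s = x' s) -> J t -> velocity x t = velocity x' t.
Proof.
move=> oJ E Jt; apply/rowP => k; rewrite !mxE.
by apply: (derive1_eq_on oJ) => // s Js; rewrite E.
Qed.

Lemma acceleration_eq_on (R : realType) n (J : set R) (x x' : R -> 'rV[R]_n) t :
  open J -> (forall s, J s -> x s = x' s) -> J t ->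
  acceleration x t = acceleration x' t.
Proof.
move=> oJ E Jt; apply/rowP => k; rewrite [LHS]mxE [RHS]mxE.
apply: (derive1_eq_on oJ _ Jt) => s Js; apply: (derive1_eq_on oJ _ Js) => r Jr.
by rewrite E.
Qed.

Lemma is_interval_normr_lt (R : realType) (d : R) : is_interval [set t : R | `|t| < d].
Proof.
move=> u v /=; rewrite !ltr_norml => /andP[u1 _] /andP[_ v2] z /andP[uz zv].
by rewrite ltr_norml (lt_le_trans u1 uz) (le_lt_trans zv v2).
Qed.

Section ProjectedGeodesics.
Variables (R : realType) (n p q : nat) (M : atlas R n) (g : riemannian M)
  (f : M -> R) (D : connection M) (G : riemannian (tensor_bundle M p q))
  (Dh : connection (tensor_bundle M p q)).
Local Notation K := (tdim n p q).
Hypothesis hM : smooth_manifold M.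
Hypothesis hf : smooth_function f.
Hypothesis hDh : metric_connection D g f G Dh.

Let oM (a : chart M) : open (chart_img a) := @open_chart_img _ _ _ hM a.

(** Christoffel symbols for rescaled_form, read off from Dh. *)
Let C (a : chart M) (h i j : 'I_n) (y : 'rV[R]_n) : R :=
  gam Dh a (lshift K h) (lshift K i) (lshift K j) (row_mx y 0).

(** The symbols of the bundle are smooth by definition of a connection, and so
    are their restrictions to the zero section. This gives a smooth
    right-hand side for the equation of rescaled_form without differentiating the
    inverse of the metric. *)
Lemma smooth_on_rescaled_symbol a h i j : smooth_on (chart_img a) (C a h i j).
Proof.
apply: smooth_on_zero_section; last exact: (gam_smooth Dh).
exact: chart_img_zero_section.
Qed.

Lemma rescaled_symbolE (a : chart M) y (v : 'rV[R]_n) h : chart_img a y ->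
  \sum_i \sum_j C a h i j y * v 0 i * v 0 j = rescaled_form D g f a y v 0 h.
Proof.
move=> ay; have aw := chart_img_zero_section p q ay.
have := bundle_conn_form oM hDh aw v 0 => /rowP/(_ (lshift K h)).
rewrite row_mxEl => <-; rewrite mxE big_split_ord/= [X in _ = _ + X]big1 ?addr0.
  apply: eq_bigr => i _; rewrite big_split_ord/= [X in _ = _ + X]big1 ?addr0.
    by apply: eq_bigr => j _; rewrite !row_mxEl.
  (* the velocity (v, 0) has no components in the fibre *)
  by move=> j _; rewrite [X in _ * X]row_mxEr [X in _ * X]mxE mulr0.
by move=> i _; rewrite big1// => j _;
  rewrite [X in _ * X * _]row_mxEr [X in _ * X * _]mxE mulr0 mul0r.
Qed.

(** The equation is solved in the coordinates of one chart. As its left-hand side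
    is a vector, the curve satisfies it in all charts. *)
Lemma rescaled_geodesic_exists (a : chart M) (x0 : M) (v0 : 'rV[R]_n) :
  chart_dom a x0 ->
  exists2 d : R, 0 < d & exists c : R -> M, let J := [set t : R | `|t| < d] in
    [/\ c 0 = x0, velocity (fun s => chart_map a (c s)) 0 = v0,
        forall t, J t -> chart_dom a (c t),
        smooth_curve J c &
        forall t, J t -> forall b : chart M, chart_dom b (c t) ->
          let x s := chart_map b (c s) in
          acceleration x t + rescaled_form D g f b (x t) (velocity x t) = 0].
Proof.
move=> ax0.
have Ux0 : chart_img a (chart_map a x0) by exists x0.
have [d d0 [x [x00 v00 Hx]]] :=
  local_second_order_solution v0 (@oM a) Ux0 (@smooth_on_rescaled_symbol a).
pose J := [set t : R | `|t| < d].
have oJ : open J by rewrite openE => t Jt; exact: near_normr_lt.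
have J0 : J 0 by rewrite /J/= normr0.
have pick t : exists z : M, J t -> chart_dom a z /\ chart_map a z = x t.
  have [Jt|nJt] := pselect (J t); last by exists x0.
  by have [[z az zx] _ _] := Hx t Jt; exists z.
have [c cP] := choice pick.
have ac t : J t -> chart_dom a (c t) by move=> /cP[].
have cx t : J t -> chart_map a (c t) = x t by move=> /cP[].
have dx t : J t -> forall k l,
    derivable (derive1n l (fun s => chart_map a (c s) 0 k)) t 1.
  move=> Jt k l; apply: (Ck_onP J _).1 Jt l => l.
  apply: (@Ck_on_eq _ _ oJ _ (fun s => x s 0 k)) => [s Js|]; first by rewrite cx.
  by move: l; apply/Ck_onP => s Js l; have [_ + _] := Hx s Js; apply.
exists d => //; exists c; rewrite -/J; split=> //.
- apply: (chart_map_inj hM (ac 0 J0) ax0); by rewrite cx.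
- rewrite (velocity_eq_on oJ cx J0); apply/rowP => k; by rewrite mxE v00.
- move=> t Jt b bt; split=> [|k l].
    have J't : (J `&` [set s | chart_dom b (c s)]) t by [].
    have := open_nbhs_nbhs (conj (open_chart_preimage hM oJ ac dx (b := b)) J't).
    by apply: filterS => s [].
  exact: (chart_change_smooth hM oJ ac dx (conj Jt bt)).
- move=> t Jt b bt xb; rewrite /xb.
  rewrite (@rescaled_form_change R n M g f hM hf D J c a b t oJ ac dx Jt bt).
  rewrite [X in X *m _](_ : _ = 0) ?mul0mx//.
  rewrite (acceleration_eq_on oJ cx Jt) (velocity_eq_on oJ cx Jt) cx//.
  apply/rowP => h; have [Ut _ /(_ h) E] := Hx t Jt.
  rewrite mxE [RHS]mxE -E [X in X + _]mxE -rescaled_symbolE//; congr (_ + _).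
  by apply: eq_bigr => i _; apply: eq_bigr => j _; rewrite !mxE.
Qed.

(** The zero tensor along any curve has vanishing covariant derivatives. *)
Lemma zero_section_geodesic (J : set R) (c : R -> M) :
  smooth_curve J c ->
  (forall t, J t -> forall b : chart M, chart_dom b (c t) ->
     let x s := chart_map b (c s) in
     acceleration x t + rescaled_form D g f b (x t) (velocity x t) = 0) ->
  geodesic Dh J (fun t => zero_section p q (c t)).
Proof.
move=> sc Hc.
have d0 t (k : 'I_K) l : derivable (derive1n l (fun _ : R => (0 : 'rV[R]_K) 0 k)) t 1.
  apply: (Ck_onP setT _).1 => // {}l; exact: (Ck_on_cst openT).
split=> t Jt b bt.
  have [nb db] := sc t Jt b bt; split=> // k l.
  rewrite -(splitK k) /unsplit; case: (fintype.split k) => j /=.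
    under [fun s => _]funext => s do rewrite row_mxEl.
    exact: db.
  under [fun s => _]funext => s do rewrite row_mxEr.
  exact: d0.
have [_ db] := sc t Jt b bt.
apply: (geodesic_equationP Dh b
  (fun s => row_mx (chart_map (b : chart M) (c s)) (0 : 'rV[R]_K)) t).2.
have bx : chart_img (b : chart M) (chart_map (b : chart M) (c t)) by exists (c t).
have aw := chart_img_zero_section p q bx.
have Z := @bundle_geodesic_equationP R n p q M D g f G Dh oM hDh b
  (fun s => chart_map (b : chart M) (c s)) (fun=> 0) t aw db (d0 t).
apply: Z.2.
split; first exact: Hc.
rewrite (nabla_along_twice D (@oM b) bx db (d0 t)).
have -> : velocity (fun _ : R => (0 : 'rV[R]_K)) t = 0.
  apply/rowP => k; rewrite !mxE; exact: derive1_cst.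
have -> : acceleration (fun _ : R => (0 : 'rV[R]_K)) t = 0.
  apply/rowP => k; rewrite !mxE /derive1n/=.
  rewrite (@derive1_eq_on _ _ openT _ (fun=> 0))//; first exact: derive1_cst.
  by move=> s _; exact: derive1_cst.
by rewrite !mul0mx mul0rn !addr0.
Qed.

Hypothesis fpos : forall x : M, 0 < f x.

(** A zero-section geodesic with initial velocity grad f projects to a curve that
    satisfies both the rescaled and the original geodesic equation, so
    rescaling_form vanishes on grad f. *)
Lemma projection_geodesic_critical :
  (forall (J : set R) (c : R -> tensor_bundle M p q),
      open J -> is_interval J -> geodesic Dh J c ->
      geodesic D J (fun t => bundle_proj (c t))) ->
  forall (a : chart M) (x : M), chart_dom a x ->
    differential_row f a (chart_map a x) = 0.
Proof.
move=> H a x ax; have ay : chart_img a (chart_map a x) by exists x.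
apply: (rescaling_form_gradient (g := g)) => //; set v := _ *m _.
have [d d0 [c [c0 cv ac sc Hc]]] := rescaled_geodesic_exists v ax.
set J := [set t : R | `|t| < d] in ac sc Hc.
have oJ : open J by rewrite openE => t Jt; exact: near_normr_lt.
have J0 : J 0 by rewrite /J/= normr0.
have [_ gc] := H J _ oJ (@is_interval_normr_lt R d) (zero_section_geodesic sc Hc).
have a0 : chart_dom a (c 0) by rewrite c0.
have := gc 0 J0 a a0 => /(geodesic_equationP D a (fun s => chart_map a (c s)) 0) E.
have := Hc 0 J0 a a0; rewrite /rescaled_form /= addrA E add0r cv c0 => /eqP.
rewrite scaler_eq0 invr_eq0 mulf_eq0 pnatr_eq0/= (in_chartE hM)// gt_eqF//=.
by move/eqP.
Qed.

Lemma critical_locally_constant (a : chart M) (x : M) :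
  (forall y, chart_img a y -> differential_row f a y = 0) -> chart_dom a x ->
  \forall y \near chart_map a x, in_chart a f y = f x.
Proof.
move=> df0 ax; have ay : chart_img a (chart_map a x) by exists x.
have /nbhs_ballP[r/= r0 rU] : nbhs (chart_map a x) (chart_img a).
  exact: open_nbhs_nbhs (conj (@oM a) ay).
apply/nbhs_ballP; exists r => //= y yr.
have [|xi xiP E] := @mean_value_ball R n (in_chart a f) (chart_map a x) r _ y
    (chart_map a x) yr (ballxx _ r0).
  move=> z zr i; apply: diff_derivable.
  exact: smooth_on_differentiable (@oM a) (@hf a) (rU _ zr).
rewrite -(in_chartE hM f ax); apply/eqP; rewrite -subr_eq0 E; apply/eqP.
rewrite big1// => i _; have := df0 _ (rU _ (xiP i)) => /rowP/(_ i).
by rewrite !mxE => ->; rewrite mulr0.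
Qed.

(** The sets where f takes, or avoids, a given value are open, since f is locally
    constant; so each level set is open and closed. *)
Lemma critical_constant : connected [set: M] ->
  (forall (a : chart M) (x : M), chart_dom a x ->
     differential_row f a (chart_map a x) = 0) ->
  exists r : R, forall x : M, f x = r.
Proof.
move=> hconn df0.
have lc (a : chart M) (x : M) : chart_dom a x ->
    \forall y \near chart_map a x, in_chart a f y = f x.
  move=> ax; apply: critical_locally_constant ax => y [z az <-]; exact: df0.
have op (P : R -> Prop) : open [set x : M | P (f x)].
  move=> x Px a ax; apply: filterS (lc a x ax) => y fy z az zy /=.
  by rewrite -(in_chartE hM f az) zy fy.
have [[x0 _]|noM] := pselect (exists x : M, True); last first.
  by exists 0 => x; exfalso; apply: noM; exists x.
exists (f x0) => x; pose E := [set z : M | f z = f x0].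
have ET : E = setT.
  apply: hconn; first by exists x0.
    by exists E; [exact: (op (fun r => r = f x0))|rewrite setTI].
  exists E; last by rewrite setTI.
  rewrite -openC; exact: (op (fun r => r <> f x0)).
by have : [set: M] x by []; rewrite -ET.
Qed.

Lemma constant_rescaled_form (r : R) (a : chart M) (y v : 'rV[R]_n) :
  (forall x : M, f x = r) -> chart_img a y ->
  rescaled_form D g f a y v = conn_form D a y v v.
Proof.
move=> fr ay; rewrite /rescaled_form rescaling_formE.
have -> : differential_row f a y = 0.
  apply/rowP => k; rewrite !mxE /partial.
  have E : \forall z \near y, (fun=> r) z = in_chart a f z.
    have := open_nbhs_nbhs (conj (@oM a) ay).
    by apply: filterS => z [x ax <-]; rewrite (in_chartE hM f ax) fr.
  by rewrite -(near_eq_derive _ E) derive_cst.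
by rewrite trmx0 mulmx0 mxE mulr0 scale0r mul0mx scaler0 subr0 scaler0 addr0.
Qed.

Lemma constant_projection_geodesic (r : R) : (forall x : M, f x = r) ->
  forall (J : set R) (c : R -> tensor_bundle M p q), geodesic Dh J c ->
  geodesic D J (fun t => bundle_proj (c t)) /\ vanishing_second_derivative D J c.
Proof.
move=> fr J c [sc gc].
have co t : J t -> forall a : chart M, chart_dom a (bundle_proj (c t)) ->
  [/\ forall k l, derivable (derive1n l (fun s => chart_map a (bundle_proj (c s)) 0 k)) t 1,
      forall k l, derivable (derive1n l (fun s => bundle_comp a (c s) 0 k)) t 1 &
      \forall s \near t, chart_dom a (bundle_proj (c s))].
  move=> Jt a at_; have [near_a da] := sc t Jt a at_.
  have El k : (fun s => @chart_map R _ (tensor_bundle M p q) a (c s) 0 (lshift K k))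
      = (fun s => chart_map a (bundle_proj (c s)) 0 k).
    by apply/funext => s; rewrite row_mxEl.
  have Er k : (fun s => @chart_map R _ (tensor_bundle M p q) a (c s) 0 (rshift n k))
      = (fun s => bundle_comp a (c s) 0 k).
    by apply/funext => s; rewrite row_mxEr.
  split; [| |exact: near_a] => k l.
    by rewrite -El; exact: (da (lshift K k) l).
  by rewrite -Er; exact: (da (rshift n k) l).
have eq t : J t -> forall a : chart M, chart_dom a (bundle_proj (c t)) ->
    let x s := chart_map a (bundle_proj (c s)) in
    let T s := bundle_comp a (c s) in
    acceleration x t + conn_form D a (x t) (velocity x t) (velocity x t) = 0 /\
    nabla_along D a x (nabla_along D a x T) t = 0.
  move=> Jt a at_ x T; have [dx dT _] := co t Jt a at_.
  have aw : @chart_img R _ (tensor_bundle M p q) a (row_mx (x t) (T t)).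
    by exists (c t).
  have E1 := (geodesic_equationP Dh a (fun s => row_mx (x s) (T s)) t).1 (gc t Jt a at_).
  have := (@bundle_geodesic_equationP R n p q M D g f G Dh oM hDh a x T t aw dx dT).1 E1.
  by rewrite (constant_rescaled_form _ fr)//; exists (bundle_proj (c t)).
split; last by move=> t Jt a at_; exact: (eq t Jt a at_).2.
split=> t Jt a at_; first by have [dx _ na] := co t Jt a at_.
exact: (geodesic_equationP D a _ t).2 (eq t Jt a at_).1.
Qed.

End ProjectedGeodesics.

Theorem theorem14 (R : realType) (n p q : nat) (M : atlas R n)
    (hM : smooth_manifold M) (hconn : connected [set: M])
    (g : riemannian M)
    (f : M -> R) (hf : smooth_function f) (fpos : forall x : M, 0 < f x)
    (D : connection M) (hD : levi_civita g D)
    (G : riemannian (tensor_bundle M p q)) (hG : rescaled_sasaki D g f G)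
    (Dh : connection (tensor_bundle M p q))
    (hDh : metric_connection D g f G Dh) :
  (forall (J : set R) (c : R -> tensor_bundle M p q),
      open J -> is_interval J -> geodesic Dh J c ->
      geodesic D J (fun t => bundle_proj (c t)) /\
      vanishing_second_derivative D J c)
  <-> (exists r : R, forall x : M, f x = r).
Proof.
split=> [H|[r fr] J c _ _ gc].
  apply: (critical_constant hM hf hconn); apply: (projection_geodesic_critical hM hf hDh fpos).
  by move=> J c oJ iJ gc; have [] := H J c oJ iJ gc.
exact: (constant_projection_geodesic hM hDh fr gc).
Qed.
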